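(* Let $N=\ell_{(p_n)}$ be a Nakano sequence space whose exponent sequence converges to $2$, let $(E_n)$ be a sequence of nonzero finite dimensional normed spaces, and let $E=\big(\bigoplus_n E_n\big)_N$ be their Nakano direct sum, with modular $\Theta$. Then for every ultrafilter $\mathcal U$ the ultrapower $E_{\mathcal U}$ has the modular decomposition $E_{\mathcal U}=E\oplus_m\mathcal H$, where $E$ is identified with its diagonal copy in $E_{\mathcal U}$ and $\mathcal H$ is the kernel of the weak limit projection $P:E_{\mathcal U}\to E$. Moreover $$\Theta_{\mathcal U}(x+h)=\Theta(x)+\|h\|^2\qquad\text{for every } x\in E,\ h\in\mathcal H.$$ If, moreover, the Jordan–von Neumann constants $a(E_n)$ converge to $1$, then $\mathcal H$ is linearly isometric to a Hilbert space, and $E$ is asymptotically hilbertian (in the isometric sense).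
   Context: Scalars are $\mathbb K\in\{\mathbb R,\mathbb C\}$. Modulars. A convex modular on a linear space $X$ is a convex function $\Theta:X\to[0,\infty)$ with $\Theta(0)=0$, $\Theta(\lambda x)=\Theta(x)$ for $|\lambda|=1$, and $\Theta(x)=0\Rightarrow x=0$; its Luxemburg norm is $\|x\|=\inf\{\lambda>0:\Theta(x/\lambda)\le1\}$. A modular space $(X,\Theta)$ has the modular decomposition $X=Y\oplus_m Z$ if $X$ is the (topological) direct sum of its subspaces $Y,Z$ and $\Theta(y+z)=\Theta(y)+\Theta(z)$ for all $y\in Y$, $z\in Z$. Nakano spaces. Given a bounded sequence of exponents $p_n\in[1,\infty)$, $n\in\mathbb N$, the Nakano sequence space $N=\ell_{(p_n)}$ is the space of scalar sequences $x=(x(n))$ with $\Theta(x)=\sum_n|x(n)|^{p_n}<\infty$, with the Luxemburg norm of $\Theta$. For normed spaces $E_n$, the Nakano direct sum $\big(\bigoplus_nE_n\big)_N$ is the space of $x=(x(n))\in\prod_nE_n$ with $(\|x(n)\|_{E_n})\in N$, with modular $\Theta(x)=\sum_n\|x(n)\|_{E_n}^{p_n}$ and its Luxemburg norm. Ultrapowers. For an ultrafilter $\mathcal U$ on a set $I$, $E_{\mathcal U}=\ell_\infty(I,E)/\{(x_i):\lim_{i,\mathcal U}\|x_i\|=0\}$ with elements $[x_i]_{\mathcal U}$; it carries the (well defined) modular $\Theta_{\mathcal U}([x_i]_{\mathcal U})=\lim_{i,\mathcal U}\Theta(x_i)$, whose Luxemburg norm is the ultrapower norm. The diagonal embedding sends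 $x\in E$ to the class of the constant family $(x)_{i\in I}$. In the situation of the claim $E$ is reflexive, and the weak limit projection is $P([x_i]_{\mathcal U})=w\text{-}\lim_{i,\mathcal U}x_i$. A reflexive Banach space $E$ is asymptotically hilbertian (in the isometric sense) if, for every ultrafilter $\mathcal U$, the kernel of the weak limit projection on $E_{\mathcal U}$ is linearly isometric to a Hilbert space. Jordan–von Neumann constant of a nonzero normed space $X$: $a(X)=\tfrac12\sup\{\|x+y\|^2+\|x-y\|^2: x,y\in X,\ \|x\|^2+\|y\|^2=1\}$. *)

(* Defs.v *)
From HB Require Import structures.
From mathcomp Require Import all_boot all_order all_algebra.
From mathcomp Require Import generic_quotient ring_quotient sesquilinear.
From mathcomp Require Import complex.
From mathcomp Require Import all_classical all_reals all_analysis.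
From mathcomp Require Import ring lra.

Set Implicit Arguments.
Unset Strict Implicit.
Unset Printing Implicit Defensive.
Import Order.TTheory GRing.Theory Num.Theory.
Import numFieldNormedType.Exports.

Local Open Scope classical_set_scope.
Local Open Scope ring_scope.

Variant scalar_kind := RealScalars | ComplexScalars.

Definition scalar_field (R : realType) (k : scalar_kind) : numFieldType :=
  match k with RealScalars => R | ComplexScalars => R[i] end.

Section Scalars.
Variables (R : realType) (k : scalar_kind).
Local Notation K := (scalar_field R k).

Definition of_real : {rmorphism R -> scalar_field R k} :=
  match k return {rmorphism R -> scalar_field R k} with
  | RealScalars => idfun
  | ComplexScalars => real_complex R
  end.

Definition re : scalar_field R k -> R :=
  match k return scalar_field R k -> R with
  | RealScalars => id
  | ComplexScalars => @complex.Re R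
  end.

Definition conj_scalar : {rmorphism scalar_field R k -> scalar_field R k} :=
  match k return {rmorphism scalar_field R k -> scalar_field R k} with
  | RealScalars => idfun
  | ComplexScalars => conjc
  end.

Lemma re_is_zmod_morphism : zmod_morphism re.
Proof. by rewrite /re; case: k => //= -[a b] [c d]. Qed.

HB.instance Definition _ :=
  GRing.isZmodMorphism.Build K R re re_is_zmod_morphism.

Lemma of_realK : cancel of_real re.
Proof. by rewrite /re /of_real; case: k. Qed.

Lemma reK (x : K) : 0 <= x -> of_real (re x) = x.
Proof.
rewrite /re /of_real; case: k x => [x _ //|[a b]].
by rewrite lecE => /andP[/eqP/= -> _].
Qed.

Lemma ler_of_real : {mono of_real : x y / x <= y}.
Proof. by rewrite /of_real; case: k => //= x y; rewrite lecR. Qed.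

Lemma ltr_of_real : {mono of_real : x y / x < y}.
Proof. exact: leW_mono ler_of_real. Qed.

Lemma normr_of_real (r : R) : 0 <= r -> `|of_real r : K| = of_real r.
Proof. by move=> r0; rewrite ger0_norm// -(rmorph0 of_real) ler_of_real. Qed.

Lemma re_gt0 (x : K) : 0 < x -> 0 < re x.
Proof. by move=> x0; rewrite -ltr_of_real reK ?ltW// rmorph0. Qed.

Lemma re_ge0 (x : K) : 0 <= x -> 0 <= re x.
Proof. by move=> x0; rewrite -ler_of_real reK// rmorph0. Qed.

Lemma re_le (x y : K) : 0 <= x -> x <= y -> re x <= re y.
Proof.
by move=> x0 xy; rewrite -ler_of_real !reK// (le_trans x0 xy).
Qed.

Lemma reM (x y : K) : 0 <= x -> 0 <= y -> re (x * y) = re x * re y.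
Proof.
by move=> x0 y0; apply: (can_inj of_realK); rewrite rmorphM !reK ?mulr_ge0.
Qed.

End Scalars.
Arguments of_real {R k}.
Arguments re {R k}.
Arguments conj_scalar {R k}.

Section Norms.
Variables (R : realType) (k : scalar_kind).
Local Notation K := (scalar_field R k).

(* The norm of a normed module over K takes its values in K; [rnorm] is the
   same norm read as a real number. *)
Definition rnorm (V : normedModType K) (x : V) : R := re `|x|.

Section Theory.
Variable V : normedModType K.
Implicit Types x y : V.

Lemma of_real_rnorm x : of_real (rnorm x) = `|x|.
Proof. by rewrite reK. Qed.

Lemma rnorm_ge0 x : 0 <= rnorm x.
Proof. exact: re_ge0. Qed.

Lemma rnorm_gt0 x : x != 0 -> 0 < rnorm x.
Proof. by move=> x0; apply: re_gt0; rewrite normr_gt0. Qed.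

Lemma rnormD x y : rnorm (x + y) <= rnorm x + rnorm y.
Proof.
by rewrite -(@ler_of_real _ k) rmorphD /= !of_real_rnorm ler_normD.
Qed.

Lemma rnormZ (a : K) x : rnorm (a *: x) = re `|a| * rnorm x.
Proof. by rewrite /rnorm normrZ reM. Qed.

Lemma rnorm0 : rnorm (0 : V) = 0.
Proof. by rewrite /rnorm normr0 raddf0. Qed.

Lemma rnormN x : rnorm (- x) = rnorm x.
Proof. by rewrite /rnorm normrN. Qed.

Lemma rnorm0_eq0 x : rnorm x = 0 -> x = 0.
Proof.
by move=> /(congr1 (@of_real R k)); rewrite of_real_rnorm rmorph0 => /normr0_eq0.
Qed.

Lemma rnorm_dist x y : `|rnorm x - rnorm y| <= rnorm (x - y).
Proof.
have h (u v : V) : rnorm u <= rnorm (u - v) + rnorm v.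
  by have := rnormD (u - v) v; rewrite subrK.
have := h x y; have := h y x; rewrite -opprB rnormN => h1 h2.
by rewrite ler_norml; apply/andP; split; lra.
Qed.

End Theory.
End Norms.

Section FromRealNorm.
Variables (R : realType) (k : scalar_kind) (V : lmodType (scalar_field R k)).
Variables (N : V -> R).
Hypothesis ND : forall x y, N (x + y) <= N x + N y.
Hypothesis NZ : forall a x, N (a *: x) = re `|a| * N x.
Hypothesis N0 : forall x, N x = 0 -> x = 0.

Lemma knormD x y :
  of_real (N (x + y)) <= of_real (N x) + of_real (N y) :> scalar_field R k.
Proof. by rewrite -rmorphD ler_of_real. Qed.

Lemma knormZ a x :
  of_real (N (a *: x)) = `|a| * of_real (N x) :> scalar_field R k.
Proof. by rewrite NZ rmorphM reK. Qed.

Lemma knorm0 x : of_real (N x) = 0 :> scalar_field R k -> x = 0.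
Proof. by move=> h; apply: N0; rewrite -[LHS](@of_realK R k) h raddf0. Qed.

End FromRealNorm.

Record convex_modular (R : realType) (k : scalar_kind)
    (V : lmodType (scalar_field R k)) :=
  ConvexModular {
    modular_fun :> V -> R;
    modular_ge0 : forall x, 0 <= modular_fun x;
    modular_convex : forall (t : R) x y, 0 <= t <= 1 ->
      modular_fun (of_real t *: x + of_real (1 - t) *: y)
      <= t * modular_fun x + (1 - t) * modular_fun y;
    modular0 : modular_fun 0 = 0;
    modular_circled : forall (a : scalar_field R k) x, `|a| = 1 ->
      modular_fun (a *: x) = modular_fun x;
    modular_eq0 : forall x, modular_fun x = 0 -> x = 0 }.

Section Luxemburg.
Variables (R : realType) (k : scalar_kind) (V : lmodType (scalar_field R k)).
Variable Theta : convex_modular V.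
Local Notation K := (scalar_field R k).

Definition luxemburg (x : V) : R :=
  inf [set r : R | 0 < r /\ Theta ((of_real r)^-1 *: x) <= 1].

Let S x := [set r : R | 0 < r /\ Theta ((of_real r)^-1 *: x) <= 1].

Lemma of_realV (r : R) : (of_real r)^-1 = of_real r^-1 :> K.
Proof. by rewrite fmorphV. Qed.

Lemma modular_scale (t : R) x : 0 <= t <= 1 -> Theta (of_real t *: x) <= t * Theta x.
Proof.
move=> t01; have := modular_convex Theta x 0 t01.
by rewrite scaler0 addr0 modular0 mulr0 addr0.
Qed.

Lemma lux_set_lb x : has_lbound (S x).
Proof. by exists 0 => r [/ltW]. Qed.

Lemma lux_set_nonempty x : S x !=set0.
Proof.
have h : 0 < Theta x + 1 by rewrite ltr_wpDl ?modular_ge0.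
exists (Theta x + 1); split => //; rewrite of_realV.
apply: le_trans (modular_scale _ _) _.
  rewrite invr_ge0 (ltW h) /= invf_le1//.
  by rewrite lerDr modular_ge0.
by rewrite ler_pdivrMl// mulr1 lerDl.
Qed.

Lemma lux_set_up x r s : S x r -> r <= s -> S x s.
Proof.
move=> [r0 h] rs; have s0 := lt_le_trans r0 rs; split => //.
have -> : (of_real s)^-1 *: x = of_real (r / s) *: ((of_real r)^-1 *: x).
  rewrite !of_realV scalerA -rmorphM; congr (of_real _ *: _).
  by rewrite mulrAC mulfV ?mul1r// gt_eqF.
apply: le_trans (modular_scale _ _) _.
  by rewrite divr_ge0 ?(ltW r0) ?(ltW s0)//= ler_pdivrMr// mul1r.
have : r / s <= 1 by rewrite ler_pdivrMr// mul1r.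
have := modular_ge0 Theta ((of_real r)^-1 *: x).
have : 0 <= r / s by rewrite divr_ge0 ?(ltW r0) ?(ltW s0).
by nra.
Qed.

Lemma lux_ltP x r : luxemburg x < r -> S x r.
Proof.
move=> h; have hinf : has_inf (S x) by split; [exact: lux_set_nonempty|exact: lux_set_lb].
have e0 : 0 < r - luxemburg x by rewrite subr_gt0.
have [s Ss] := inf_adherent e0 hinf.
rewrite -/(luxemburg x) addrC subrK => /ltW; exact: lux_set_up.
Qed.

Lemma lux_le x r : S x r -> luxemburg x <= r.
Proof. by move=> Sr; apply: ge_inf => //; exact: lux_set_lb. Qed.

Lemma luxemburg_ge0 x : 0 <= luxemburg x.
Proof. by apply: lb_le_inf; [exact: lux_set_nonempty|move=> r [/ltW]]. Qed.

Lemma luxemburg0 : luxemburg 0 = 0.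
Proof.
apply/eqP; rewrite eq_le luxemburg_ge0 andbT; apply/ler_addgt0Pr => e e0.
by rewrite add0r; apply: lux_le; split => //; rewrite scaler0 modular0.
Qed.

Lemma luxemburgD x y : luxemburg (x + y) <= luxemburg x + luxemburg y.
Proof.
apply/ler_addgt0Pr => e e0.
have e2 : 0 < e / 2 by lra.
have [|r0 hr] := @lux_ltP x (luxemburg x + e / 2); first by lra.
have [|s0 hs] := @lux_ltP y (luxemburg y + e / 2); first by lra.
set r := luxemburg x + e / 2 in r0 hr.
set s := luxemburg y + e / 2 in s0 hs.
have -> : luxemburg x + luxemburg y + e = r + s by rewrite /r /s; lra.
have rs0 : 0 < r + s by lra.
apply: lux_le; split => //.
pose t := r / (r + s).
have t1 : 1 - t = s / (r + s) by rewrite /t; field; lra.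
have -> : (of_real (r + s))^-1 *: (x + y) =
  of_real t *: ((of_real r)^-1 *: x) + of_real (1 - t) *: ((of_real s)^-1 *: y).
  rewrite t1 !of_realV !scalerA -!rmorphM scalerDr.
  by congr (of_real _ *: _ + of_real _ *: _); rewrite /t; field; lra.
have t0 : 0 <= t by rewrite divr_ge0// ltW.
have t0' : 0 <= 1 - t by rewrite t1 divr_ge0// ltW.
apply: le_trans (modular_convex Theta _ _ _) _; first by lra.
by nra.
Qed.

Lemma luxemburgZ (a : K) x : luxemburg (a *: x) = re `|a| * luxemburg x.
Proof.
have hle (b : K) y : b != 0 -> luxemburg (b *: y) <= re `|b| * luxemburg y.
  move=> b0; have rb0 : 0 < re `|b| by apply: re_gt0; rewrite normr_gt0.
  rewrite -ler_pdivrMl//; apply/ler_addgt0Pr => e e0.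
  have [|r0 hr] := @lux_ltP y (luxemburg y + e); first by lra.
  set r := luxemburg y + e in r0 hr *.
  rewrite ler_pdivrMl//; apply: lux_le; split; first by rewrite mulr_gt0.
  rewrite [X in Theta X](_ : _ = (b / `|b|) *: ((of_real r)^-1 *: y)).
    by rewrite modular_circled// normf_div normr_id divff ?normr_eq0.
  by rewrite !scalerA rmorphM reK// invfM mulrC mulrA.
have [->|a0] := eqVneq a 0; first by rewrite scale0r luxemburg0 normr0 raddf0 mul0r.
apply/eqP; rewrite eq_le hle//=.
have ra0 : 0 < re `|a| by apply: re_gt0; rewrite normr_gt0.
have := hle a^-1 (a *: x); rewrite invr_eq0 => /(_ a0).
rewrite scalerA mulVf// scale1r normfV.
rewrite -{1}[`|a|]reK// of_realV of_realK.
by rewrite ler_pdivlMl.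
Qed.

Lemma luxemburg_eq0 x : luxemburg x = 0 -> x = 0.
Proof.
move=> h; apply: (modular_eq0 (c := Theta)).
apply/eqP; rewrite eq_le modular_ge0 andbT; apply/ler_addgt0Pr => e e0.
pose t := Num.min e 1.
have t0 : 0 < t by rewrite lt_min e0/=.
have [|_ ht] := @lux_ltP x t; first by rewrite h.
have -> : x = of_real t *: ((of_real t)^-1 *: x).
  by rewrite of_realV scalerA -rmorphM divff ?rmorph1 ?scale1r// gt_eqF.
apply: le_trans (modular_scale _ _) _.
  by rewrite (ltW t0)/= ge_min lexx orbT.
have te : t <= e by rewrite ge_min lexx.
by have := modular_ge0 Theta ((of_real t)^-1 *: x); nra.
Qed.

(* An alias of V that carries the Luxemburg norm of the modular. *)
Definition modular_space & convex_modular V : Type := V.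

HB.instance Definition _ := GRing.Lmodule.on (modular_space Theta).
HB.instance Definition _ := Lmodule_isNormed.Build K (modular_space Theta)
  (knormD luxemburgD) (knormZ luxemburgZ) (knorm0 luxemburg_eq0).

End Luxemburg.

Record exponents (R : realType) := Exponents {
  exponent :> nat -> R;
  exponent_ge1 : forall n, 1 <= exponent n;
  exponent_bounded : exists M, forall n, exponent n <= M }.

(* The library's \sum_(n <oo) of nonnegative terms is always defined in
   [0, +oo], so that the finiteness in [nakano] is meaningful. *)
Definition nakano_series (R : realType) (k : scalar_kind) (p : exponents R)
    (t : nat -> scalar_field R k) : \bar R :=
  (\sum_(n <oo) (re `|t n| `^ p n)%:E)%E.

Definition nakano (R : realType) (k : scalar_kind) (p : exponents R) :
    set (nat -> scalar_field R k) :=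
  [set t | (nakano_series p t < +oo)%E].

Section ProductSpace.
Variables (K : pzRingType) (E_ : nat -> lmodType K).

Definition prod_space : Type := forall n, E_ n.

HB.instance Definition _ := Choice.copy prod_space (forall n, E_ n).

Let add (x y : prod_space) : prod_space := fun n => x n + y n.
Let opp (x : prod_space) : prod_space := fun n => - x n.
Let scale (a : K) (x : prod_space) : prod_space := fun n => a *: x n.

Lemma prod_addA : associative add.
Proof. by move=> x y z; apply: functional_extensionality_dep => n; exact: addrA. Qed.
Lemma prod_addC : commutative add.
Proof. by move=> x y; apply: functional_extensionality_dep => n; exact: addrC. Qed.
Lemma prod_add0 : left_id (fun n => 0 : E_ n) add.
Proof. by move=> x; apply: functional_extensionality_dep => n; exact: add0r. Qed.
Lemma prod_addN : left_inverse (fun n => 0 : E_ n) opp add.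
Proof. by move=> x; apply: functional_extensionality_dep => n; exact: addNr. Qed.

HB.instance Definition _ :=
  GRing.isZmodule.Build prod_space prod_addA prod_addC prod_add0 prod_addN.

Lemma prod_scaleA a b x : scale a (scale b x) = scale (a * b) x.
Proof. by apply: functional_extensionality_dep => n; exact: scalerA. Qed.
Lemma prod_scale1 : left_id 1 scale.
Proof. by move=> x; apply: functional_extensionality_dep => n; exact: scale1r. Qed.
Lemma prod_scaleDr : right_distributive scale +%R.
Proof. by move=> a x y; apply: functional_extensionality_dep => n; exact: scalerDr. Qed.
Lemma prod_scaleDl x : {morph scale^~ x : a b / a + b}.
Proof. by move=> a b; apply: functional_extensionality_dep => n; exact: scalerDl. Qed.

HB.instance Definition _ := GRing.Zmodule_isLmodule.Build K prod_space
  prod_scaleA prod_scale1 prod_scaleDr prod_scaleDl.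

End ProductSpace.

Section NakanoSum.
Variables (R : realType) (k : scalar_kind) (p : exponents R).
Local Notation K := (scalar_field R k).
Variable E_ : nat -> normedModType K.
Local Notation prodE := (prod_space E_).
Implicit Types x y : prodE.

(* A family x belongs to the direct sum iff the sequence of the norms of its
   terms, which are scalars in K, lies in the Nakano sequence space. *)
Definition nakano_pred : pred prodE :=
  fun x => `[< nakano p (fun n => `|x n|) >].

Let S (x : prodE) : \bar R := (\sum_(n <oo) (rnorm (x n) `^ p n)%:E)%E.

Lemma nakano_seriesE x : nakano_series p (fun n => `|x n|) = S x.
Proof. by apply: eq_eseriesr => n _; rewrite normr_id. Qed.

Let p0 n : 0 < p n.
Proof. exact: lt_le_trans ltr01 (exponent_ge1 p n). Qed.

Let t0 x n : (0%:E <= (rnorm (x n) `^ p n)%:E)%E.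
Proof. by rewrite lee_fin powR_ge0. Qed.

Lemma nakano_le (c d : R) x y z : 0 <= c -> 0 <= d ->
  (forall n, rnorm (z n) `^ p n <= c * rnorm (x n) `^ p n + d * rnorm (y n) `^ p n) ->
  (S z <= c%:E * S x + d%:E * S y)%E.
Proof.
move=> c0 d0 h.
rewrite -!nneseriesZl// -?nneseriesD//.
- apply: lee_nneseries => n _ //.
  by rewrite -!EFinM -EFinD lee_fin.
- by move=> n _ _; rewrite mule_ge0.
- by move=> n _ _; rewrite mule_ge0.
Qed.

Let powR_mono n : {in Num.nneg &, {homo (@powR R ^~ (p n)) : u v / u <= v}}.
Proof. by apply: ge0_ler_powR; exact: ltW. Qed.

Lemma nakano_submod_closed : submod_closed nakano_pred.
Proof.
have inE' x : (x \in nakano_pred) = (S x < +oo)%E.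
  by apply/idP/idP => [/asboolP|h]; [|apply/asboolP]; rewrite /nakano/= nakano_seriesE.
split.
  rewrite inE' /S eseries0// => n _ _.
  by rewrite rnorm0 powR0// gt_eqF.
move=> a x y; rewrite !inE' => Sx Sy.
have [M hM] := exponent_bounded p.
pose A := Num.max 1 (re `|a|).
have A1 : 1 <= A by rewrite le_max lexx.
have Aa : re `|a| <= A by rewrite le_max lexx orbT.
pose C := (2 * A) `^ M.
have C0 : 0 <= C by exact: powR_ge0.
apply: (@le_lt_trans _ _ (C%:E * S x + C%:E * S y)%E).
  apply: nakano_le => // n.
  have hx := rnorm_ge0 (x n); have hy := rnorm_ge0 (y n).
  pose m := Num.max (rnorm (x n)) (rnorm (y n)).
  have m0 : 0 <= m by rewrite le_max hx.
  have xm : rnorm (x n) <= m by rewrite le_max lexx.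
  have ym : rnorm (y n) <= m by rewrite le_max lexx orbT.
  have hz : rnorm ((a *: x + y) n) <= 2 * A * m.
    apply: le_trans (rnormD _ _) _; rewrite rnormZ.
    have : re `|a| * rnorm (x n) <= A * m by apply: ler_pM => //; exact: re_ge0.
    by nra.
  apply: (@le_trans _ _ ((2 * A * m) `^ p n)).
    by apply: powR_mono => //; rewrite nnegrE ?rnorm_ge0//; nra.
  rewrite powRM//; last by lra.
  apply: (@le_trans _ _ (C * m `^ p n)).
    by apply: ler_wpM2r; [exact: powR_ge0|apply: ler_powR => //; lra].
  rewrite -mulrDr ler_wpM2l//.
  have [->|->] : m = rnorm (x n) \/ m = rnorm (y n).
    by rewrite /m maxEle; case: ifP; [right|left].
  - by rewrite lerDl powR_ge0.
  - by rewrite lerDr powR_ge0.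
by rewrite lte_add_pinfty// lte_mul_pinfty// ?lee_fin// nneseries_ge0.
Qed.

HB.instance Definition _ := GRing.isSubmodClosed.Build K prodE nakano_pred
  nakano_submod_closed.

Record nakano_vect := NakanoVect {
  nakano_seq : prodE;
  nakano_seqP : nakano_seq \in nakano_pred }.

HB.instance Definition _ := [isSub for nakano_seq].
HB.instance Definition _ := [Choice of nakano_vect by <:].
HB.instance Definition _ := [SubChoice_isSubLmodule of nakano_vect by <:].

Definition nakano_theta (x : nakano_vect) : R :=
  fine (nakano_series p (fun n => `|nakano_seq x n|)).

Let thetaE (x : nakano_vect) : (nakano_theta x)%:E = S (nakano_seq x).
Proof.
rewrite /nakano_theta nakano_seriesE fineK// ge0_fin_numE ?nneseries_ge0//.
by have /asboolP := nakano_seqP x; rewrite /nakano/= nakano_seriesE.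
Qed.

Lemma nakano_theta_ge0 (x : nakano_vect) : 0 <= nakano_theta x.
Proof. by rewrite -lee_fin thetaE nneseries_ge0. Qed.

Lemma nakano_theta_convex (t : R) (x y : nakano_vect) : 0 <= t <= 1 ->
  nakano_theta (of_real t *: x + of_real (1 - t) *: y)
  <= t * nakano_theta x + (1 - t) * nakano_theta y.
Proof.
move=> t01; have [t_0 t_1] := andP t01.
rewrite -lee_fin EFinD !EFinM !thetaE; apply: nakano_le => [//||n]; first by lra.
have hz : rnorm (nakano_seq (of_real t *: x + of_real (1 - t) *: y) n)
    <= t * rnorm (nakano_seq x n) + (1 - t) * rnorm (nakano_seq y n).
  apply: le_trans (rnormD _ _) _.
  by rewrite !rnormZ !normr_of_real ?subr_ge0// !of_realK.
have hx := rnorm_ge0 (nakano_seq x n); have hy := rnorm_ge0 (nakano_seq y n).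
apply: (@le_trans _ _
    ((t * rnorm (nakano_seq x n) + (1 - t) * rnorm (nakano_seq y n)) `^ p n)).
  by apply: powR_mono => //; rewrite nnegrE ?rnorm_ge0//; nra.
have := @convex_powR R (p n) (exponent_ge1 p n) (Itv01 t_0 t_1)
  (rnorm (nakano_seq x n)) (rnorm (nakano_seq y n)).
rewrite !inE/= !in_itv/= !andbT => /(_ hx hy).
by rewrite !convRE.
Qed.

Lemma nakano_theta0 : nakano_theta 0 = 0.
Proof.
apply: EFin_inj; rewrite thetaE /S eseries0// => n _ _.
by rewrite rnorm0 powR0// gt_eqF.
Qed.

Lemma nakano_theta_circled (a : K) (x : nakano_vect) : `|a| = 1 ->
  nakano_theta (a *: x) = nakano_theta x.
Proof.
move=> a1; apply: EFin_inj; rewrite !thetaE; apply: eq_eseriesr => n _.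
by rewrite rnormZ a1 -[X in re X](rmorph1 (@of_real R k)) of_realK mul1r.
Qed.

Lemma nakano_theta_eq0 (x : nakano_vect) : nakano_theta x = 0 -> x = 0.
Proof.
move=> h0; have h : S (nakano_seq x) = 0%:E by rewrite -thetaE h0.
apply: val_inj => /=.
apply: functional_extensionality_dep => n; apply: rnorm0_eq0.
apply: (@powR_eq0_eq0 _ _ (p n)); apply/eqP; rewrite eq_le powR_ge0 andbT.
rewrite -lee_fin -[leRHS]h /S (@nneseriesD1 _ _ n)// leeDl//.
by apply: nneseries_ge0 => m _ _.
Qed.

Definition nakano_modular : convex_modular nakano_vect :=
  ConvexModular nakano_theta_ge0 nakano_theta_convex nakano_theta0
    nakano_theta_circled nakano_theta_eq0.

Definition nakano_sum : normedModType K := modular_space nakano_modular.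

End NakanoSum.

Section Dual.
Variables (R : realType) (k : scalar_kind).
Local Notation K := (scalar_field R k).
Variable V : normedModType K.

Definition dual_pred : pred (V -> K^o) :=
  fun f => `[< GRing.linear_for *:%R f /\ continuous f >].

Lemma dual_submod_closed : submod_closed dual_pred.
Proof.
split; first by apply/asboolP; split=> [a x y|x]; [rewrite scaler0 addr0|exact: cvg_cst].
move=> a f g /asboolP[fl fc] /asboolP[gl gc]; apply/asboolP; split => [b x y|x].
  rewrite /= /GRing.add/= /GRing.scale/= fl gl /GRing.scale/=.
  by rewrite !mulrDr !mulrA [a * b]mulrC addrACA.
have h : continuous (fun y => a *: f y + g y).
  by move=> y; apply: cvgD; [apply: cvgZl_tmp; exact: fc|exact: gc].
exact: h.
Qed.

HB.instance Definition _ := GRing.isSubmodClosed.Build K (V -> K^o) dual_pred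
  dual_submod_closed.

(* The continuous linear functionals on V, with the usual dual norm. *)
Record cont_dual := ContDual {
  dual_fun :> V -> K^o;
  dual_funP : dual_fun \in dual_pred }.

HB.instance Definition _ := [isSub for dual_fun].
HB.instance Definition _ := [Choice of cont_dual by <:].
HB.instance Definition _ := [SubChoice_isSubLmodule of cont_dual by <:].

Implicit Types f g : cont_dual.

Definition dual_norm f : R :=
  sup [set rnorm (f x) | x in [set x | rnorm x <= 1]].

Lemma dual_linear f a x y : f (a *: x + y) = a *: f x + f y.
Proof. by have /asboolP[fl _] := dual_funP f; exact: fl. Qed.

Lemma dual0 f : f 0 = 0.
Proof. by have := dual_linear f (-1) 0 0; rewrite !scaleN1r !addNr. Qed.

Lemma dualZ f a x : f (a *: x) = a *: f x.
Proof. by have := dual_linear f a x 0; rewrite dual0 !addr0. Qed.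

Lemma dual_bounded f : exists C : R, forall x, rnorm (f x) <= C * rnorm x.
Proof.
have /asboolP[_ /(_ 0)] := dual_funP f.
move=> /cvgrPdist_le/(_ 1 ltr01)/nbhs_ballP[e /= e0 he].
have re0 : 0 < re e by exact: re_gt0.
exists (2 / re e) => x.
have [->|x0] := eqVneq x 0; first by rewrite dual0 !rnorm0 mulr0.
have nx0 := rnorm_gt0 x0.
pose c : R := re e / 2 / rnorm x.
have c0 : 0 < c by rewrite !divr_gt0.
have nc : `|of_real c : K| = of_real c.
  by rewrite normr_of_real// ltW.
have : `|f (of_real c *: x)| <= 1.
  have := he (of_real c *: x).
  rewrite -ball_normE /= dual0 !sub0r !normrN; apply.
  rewrite normrZ nc -of_real_rnorm -rmorphM /= -[ltRHS]reK ?ltW//.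
  by rewrite ltr_of_real /c divfK ?gt_eqF//; lra.
rewrite dualZ normrZ nc -of_real_rnorm -rmorphM/= -(rmorph1 (@of_real R k)).
rewrite ler_of_real -ler_pdivlMl// /c => /le_trans; apply.
rewrite mulr1 le_eqVlt; apply/orP; left; apply/eqP.
by field; rewrite !gt_eqF.
Qed.

Lemma dual_norm_has_sup f : has_sup [set rnorm (f x) | x in [set x | rnorm x <= 1]].
Proof.
split; first by exists (rnorm (f 0)), 0; rewrite //= rnorm0.
have [C hC] := dual_bounded f; exists `|C| => _ [x /= x1 <-].
apply: le_trans (hC x) _; have := rnorm_ge0 x; have := ler_norm C.
by have := normr_ge0 C; nra.
Qed.

Lemma dual_norm_ub f x : rnorm x <= 1 -> rnorm (f x) <= dual_norm f.
Proof. by move=> x1; apply: ub_le_sup; [case: (dual_norm_has_sup f)|exists x]. Qed.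

Lemma dual_norm_le f C : (forall x, rnorm x <= 1 -> rnorm (f x) <= C) -> dual_norm f <= C.
Proof.
move=> h; apply: ge_sup; first by case: (dual_norm_has_sup f).
by move=> _ [x /= x1 <-]; exact: h.
Qed.

Lemma dual_normD f g : dual_norm (f + g) <= dual_norm f + dual_norm g.
Proof.
apply: dual_norm_le => x x1; apply: le_trans (rnormD _ _) _.
by apply: lerD; exact: dual_norm_ub.
Qed.

Lemma dual_norm_ge0 f : 0 <= dual_norm f.
Proof. by apply: le_trans (@dual_norm_ub f 0 _); rewrite ?rnorm_ge0// rnorm0. Qed.

Lemma dual_normZ (a : K) f : dual_norm (a *: f) = re `|a| * dual_norm f.
Proof.
have hle (b : K) g : dual_norm (b *: g) <= re `|b| * dual_norm g.
  apply: dual_norm_le => x x1; rewrite rnormZ.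
  by rewrite ler_wpM2l ?re_ge0// dual_norm_ub.
have [->|a0] := eqVneq a 0.
  rewrite scale0r normr0 raddf0 mul0r; apply/eqP; rewrite eq_le dual_norm_ge0 andbT.
  by apply: dual_norm_le => x _; rewrite rnorm0.
apply/eqP; rewrite eq_le hle/=.
have := hle a^-1 (a *: f); rewrite scalerA mulVf// scale1r.
have ra : 0 < re `|a| by apply: re_gt0; rewrite normr_gt0.
by rewrite normfV -{1}[`|a|]reK// of_realV of_realK ler_pdivlMl.
Qed.

Lemma dual_norm_eq0 f : dual_norm f = 0 -> f = 0.
Proof.
move=> f0; apply: val_inj; apply/funext => x /=.
have [->|x0] := eqVneq x 0; first by rewrite dual0.
have nx0 := rnorm_gt0 x0.
have nc : `|of_real (rnorm x)^-1 : K| = of_real (rnorm x)^-1.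
  by rewrite normr_of_real// invr_ge0 ltW.
have := @dual_norm_ub f (of_real (rnorm x)^-1 *: x).
rewrite dualZ !rnormZ nc of_realK mulVf ?gt_eqF// => /(_ (lexx _)).
rewrite f0 pmulr_rle0 ?invr_gt0// => h.
by apply: rnorm0_eq0; apply/eqP; rewrite eq_le h rnorm_ge0.
Qed.

HB.instance Definition _ := Lmodule_isNormed.Build K cont_dual
  (knormD dual_normD) (knormZ dual_normZ) (knorm0 dual_norm_eq0).

End Dual.

(* The canonical embedding of V into its bidual is onto. *)
Definition reflexive_space (R : realType) (k : scalar_kind)
    (V : normedModType (scalar_field R k)) : Prop :=
  forall phi : cont_dual (cont_dual V), exists x : V, forall f : cont_dual V, phi f = f x.

Record ultrafilter (I : Type) := Ultrafilter {
  ultra_sets :> set_system I;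
  ultrafilterP : UltraFilter ultra_sets }.
#[global] Existing Instance ultrafilterP.

Lemma ultra_bounded_cvg (R : realType) (I : Type) (U : ultrafilter I) (g : I -> R)
    (M : R) : (forall i, `|g i| <= M) -> cvg (g i @[i --> ultra_sets U]).
Proof.
move=> gM.
have Ug : ultra_sets U (g @^-1` `[- M, M]).
  by apply: filterE => i; rewrite /= in_itv/= -ler_norml.
have [l [_ Ul]] := @segment_compact R (- M) M (g @ ultra_sets U) _ Ug.
apply/cvg_ex; exists l => A Al.
have [//|h] := in_ultra_setVsetC (g @^-1` A) (ultrafilterP U).
by have [y [nAy Ay]] := Ul (~` A) A h Al.
Qed.

Section Ultrapower.
Variables (R : realType) (k : scalar_kind).
Local Notation K := (scalar_field R k).
Variables (V : normedModType K) (I : Type).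

Definition linfty_pred : pred (I -> V) :=
  fun x => `[< exists M : R, forall i, rnorm (x i) <= M >].

Lemma linfty_submod_closed : submod_closed linfty_pred.
Proof.
split; first by apply/asboolP; exists 0 => i; rewrite rnorm0.
move=> a x y /asboolP[M hM] /asboolP[N hN]; apply/asboolP.
exists (re `|a| * M + N) => i; apply: le_trans (rnormD _ _) _.
by rewrite rnormZ lerD// ler_wpM2l// re_ge0.
Qed.

HB.instance Definition _ := GRing.isSubmodClosed.Build K (I -> V) linfty_pred
  linfty_submod_closed.

Record linfty := Linfty {
  linfty_fun :> I -> V;
  linfty_funP : linfty_fun \in linfty_pred }.

HB.instance Definition _ := [isSub for linfty_fun].
HB.instance Definition _ := [Choice of linfty by <:].
HB.instance Definition _ := [SubChoice_isSubLmodule of linfty by <:].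

Lemma linfty_cst_subproof (v : V) : (fun=> v) \in linfty_pred.
Proof. by apply/asboolP; exists (rnorm v). Qed.

Definition linfty_cst (v : V) : linfty := Linfty (linfty_cst_subproof v).

Variable U : ultrafilter I.

Lemma linfty_rnorm_cvg (x : linfty) : cvg (rnorm (x i) @[i --> ultra_sets U]).
Proof.
have /asboolP[M hM] := linfty_funP x.
by apply: (@ultra_bounded_cvg _ _ _ _ M) => i; rewrite ger0_norm ?rnorm_ge0.
Qed.

Definition null_pred : {pred linfty} :=
  fun x => `[< rnorm (x i) @[i --> ultra_sets U] --> (0 : R) >].

Lemma null_pred_squeeze (f g : I -> R) : (forall i, 0 <= f i <= g i) ->
  g i @[i --> ultra_sets U] --> (0 : R) -> f i @[i --> ultra_sets U] --> (0 : R).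
Proof.
move=> fg g0; apply: (squeeze_cvgr _ (cvg_cst _) g0).
exact: filterE.
Qed.

Lemma null_zmod_closed : zmod_closed null_pred.
Proof.
split.
  apply/asboolP; rewrite (_ : (fun i => _) = (fun=> 0)); first exact: cvg_cst.
  by apply/funext => i; rewrite rnorm0.
move=> x y /asboolP hx /asboolP hy; apply/asboolP.
apply: (@null_pred_squeeze _ (fun i => rnorm (x i) + rnorm (y i))).
  by move=> i; rewrite rnorm_ge0/= (le_trans (rnormD _ _))// rnormN.
by rewrite -[X in _ --> X](addr0 0); exact: cvgD.
Qed.

HB.instance Definition _ := GRing.isZmodClosed.Build linfty null_pred
  null_zmod_closed.

(* The library's quotient of the additive group of bounded families by the
   subgroup of the families that are null along U; the scaling and the norm
   (the limit of the norms along U) are added below. *)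
Definition ultrapower : Type := @Quotient.quot linfty null_pred.

HB.instance Definition _ := GRing.Zmodule.on ultrapower.
HB.instance Definition _ := EqQuotient.on ultrapower.

Definition uclass (x : linfty) : ultrapower :=
  (\pi_(@Quotient.quot linfty null_pred) x)%qT.

Definition urepr (q : ultrapower) : linfty :=
  repr (q : @Quotient.quot linfty null_pred).

Lemma ureprK : cancel urepr uclass.
Proof. exact: reprK. Qed.

Lemma uclassP (x y : linfty) :
  (uclass x = uclass y) <-> (rnorm (x i - y i) @[i --> ultra_sets U] --> (0 : R)).
Proof.
split=> [/eqP|h].
  by rewrite /uclass -Quotient.idealrBE => /asboolP.
by apply/eqP; rewrite /uclass -Quotient.idealrBE; apply/asboolP.
Qed.

Lemma uclassD x y : uclass (x + y) = uclass x + uclass y.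
Proof. exact: raddfD. Qed.

Lemma urepr_null (x : linfty) :
  rnorm (urepr (uclass x) i - x i) @[i --> ultra_sets U] --> (0 : R).
Proof. by apply/uclassP; exact: ureprK. Qed.

Definition uscale (a : K) (q : ultrapower) : ultrapower := uclass (a *: urepr q).

Lemma uscale_class a x : uscale a (uclass x) = uclass (a *: x).
Proof.
apply/uclassP.
apply: (@null_pred_squeeze _ (fun i => re `|a| * rnorm (urepr (uclass x) i - x i))).
  by move=> i; rewrite rnorm_ge0/= -rnormZ scalerBr.
by rewrite -[X in _ --> X](mulr0 (re `|a|)); apply: cvgMr; exact: urepr_null.
Qed.

Lemma uscaleA a b q : uscale a (uscale b q) = uscale (a * b) q.
Proof. by rewrite -(ureprK q) !uscale_class scalerA. Qed.
Lemma uscale1 : left_id 1 uscale.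
Proof. by move=> q; rewrite -(ureprK q) uscale_class scale1r. Qed.
Lemma uscaleDr : right_distributive uscale +%R.
Proof.
move=> a p q; rewrite -(ureprK p) -(ureprK q) -uclassD !uscale_class scalerDr.
exact: uclassD.
Qed.
Lemma uscaleDl q : {morph uscale^~ q : a b / a + b}.
Proof.
move=> a b; rewrite -(ureprK q) !uscale_class scalerDl; exact: uclassD.
Qed.

HB.instance Definition _ := GRing.Zmodule_isLmodule.Build K ultrapower
  uscaleA uscale1 uscaleDr uscaleDl.

Definition unorm (q : ultrapower) : R :=
  lim (rnorm (urepr q i) @[i --> ultra_sets U]).

Lemma unorm_class (x : linfty) : rnorm (x i) @[i --> ultra_sets U] --> unorm (uclass x).
Proof.
have h : rnorm (urepr (uclass x) i) - rnorm (x i) @[i --> ultra_sets U] --> (0 : R).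
  apply/norm_cvg0P.
  have hle i : 0 <= `|rnorm (urepr (uclass x) i) - rnorm (x i)|
      <= rnorm (urepr (uclass x) i - x i) by rewrite normr_ge0 rnorm_dist.
  exact: null_pred_squeeze hle (@urepr_null x).
have := cvgB (@linfty_rnorm_cvg (urepr (uclass x))) h; rewrite subr0.
have e : (fun i => rnorm (x i)) = (fun i => rnorm (urepr (uclass x) i) -
    (rnorm (urepr (uclass x) i) - rnorm (x i))).
  by apply/funext => i; rewrite subKr.
by rewrite e; apply.
Qed.

Lemma unormE (x : linfty) : unorm (uclass x) = lim (rnorm (x i) @[i --> ultra_sets U]).
Proof. by apply/esym/cvg_lim => //; exact: unorm_class. Qed.

Lemma unormD p q : unorm (p + q) <= unorm p + unorm q.
Proof.
rewrite -(ureprK p) -(ureprK q) -uclassD.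
rewrite -subr_ge0.
have h : rnorm (urepr p i) + rnorm (urepr q i) - rnorm (urepr p i + urepr q i)
    @[i --> ultra_sets U] --> unorm (uclass (urepr p)) + unorm (uclass (urepr q))
      - unorm (uclass (urepr p + urepr q)).
  apply: cvgB; last exact: unorm_class.
  by apply: cvgD; exact: unorm_class.
apply: (cvgr_to_ge h).
by apply: (@filterE _ (ultra_sets U)) => i; rewrite subr_ge0 rnormD.
Qed.

Lemma unormZ a q : unorm (a *: q) = re `|a| * unorm q.
Proof.
rewrite -(ureprK q); have -> : a *: uclass (urepr q) = uclass (a *: urepr q) by exact: uscale_class.
rewrite unormE; apply/cvg_lim => //.
under eq_fun do rewrite rnormZ.
by apply: cvgMr; exact: unorm_class.
Qed.

Lemma unorm_eq0 q : unorm q = 0 -> q = 0.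
Proof.
move=> q0; rewrite -(ureprK q) -(raddf0 (\pi_(@Quotient.quot linfty null_pred))%qT).
apply/(uclassP (urepr q) 0); rewrite -q0 -{2}(ureprK q).
under eq_fun do rewrite subr0.
exact: unorm_class.
Qed.

HB.instance Definition _ := Lmodule_isNormed.Build K ultrapower
  (knormD unormD) (knormZ unormZ) (knorm0 unorm_eq0).

Definition diag_embed (v : V) : ultrapower := uclass (linfty_cst v).

End Ultrapower.

Section Notions.
Variables (R : realType) (k : scalar_kind).
Local Notation K := (scalar_field R k).

Definition finite_dimensional (V : lmodType K) : Prop :=
  exists (d : nat) (b : 'I_d -> V),
    forall v, exists c : 'I_d -> K, v = \sum_(i < d) c i *: b i.

(* Only meaningful for V != 0, where the set below is nonempty and bounded. *)
Definition jordan_von_neumann (V : normedModType K) : R :=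
  2^-1 * sup [set r | exists x y : V, rnorm x ^+ 2 + rnorm y ^+ 2 = 1 /\
                       r = rnorm (x + y) ^+ 2 + rnorm (x - y) ^+ 2].

Definition linear_subspace (V : lmodType K) (S : set V) : Prop :=
  S 0 /\ forall (a : K) x y, S x -> S y -> S (a *: x + y).

Definition topological_direct_sum (V : normedModType K) (Y Z : set V) : Prop :=
  [/\ linear_subspace Y, linear_subspace Z, Y `&` Z = [set 0]
    & exists f g : V -> V, [/\ continuous f, continuous g
        & forall x, [/\ Y (f x), Z (g x) & x = f x + g x]]].

Definition modular_decomposition (V : normedModType K) (Theta : V -> R)
    (Y Z : set V) : Prop :=
  topological_direct_sum Y Z /\
  forall y z, Y y -> Z z -> Theta (y + z) = Theta y + Theta z.

Definition banach_space (V : normedModType K) : Prop :=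
  forall F : set_system V, ProperFilter F -> cauchy F -> cvg F.

(* {dot G for conj_scalar} is the library's type of positive definite forms
   that are linear in the first argument and conjugate symmetric. *)
Definition hilbert_space (G : completeNormedModType K) : Prop :=
  exists dot : {dot G for @conj_scalar R k}, forall x, dot x x = `|x| ^+ 2.

Definition isometric_to_hilbert (V : normedModType K) (H : set V) : Prop :=
  exists G : completeNormedModType K, hilbert_space G /\
  exists f : {linear G -> V}, (forall x, `|f x| = `|x|) /\ range f = H.

Section Ultra.
Variables (V : normedModType K) (I : Type) (U : ultrafilter I).

(* The limit is taken on a representative of the class. *)
Definition ultra_modular (Theta : V -> R) (q : ultrapower V U) : R :=
  lim (Theta (urepr q i) @[i --> ultra_sets U]).

Definition weak_limit (x : I -> V) (l : V) : Prop :=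
  forall f : cont_dual V, f (x i) @[i --> ultra_sets U] --> f l.

Definition ultra_weak_limit (q : ultrapower V U) (l : V) : Prop :=
  forall x : linfty V I, uclass U x = q -> weak_limit x l.

(* The value 0 is a dummy for classes whose representatives have no weak limit
   along U; there are none in a reflexive space. *)
Definition weak_limit_proj (q : ultrapower V U) : V :=
  xget 0 [set l | ultra_weak_limit q l].

Definition weak_kernel : set (ultrapower V U) :=
  [set q | weak_limit_proj q = 0].

End Ultra.
Arguments weak_kernel V {I} U.

Definition asymptotically_hilbertian (V : normedModType K) : Prop :=
  [/\ banach_space V, reflexive_space V
    & forall (I : Type) (U : ultrafilter I),
      isometric_to_hilbert (@weak_kernel V I U)].

End Notions.
Arguments ultra_modular {R k V I} U.
Arguments weak_kernel {R k} V {I} U.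

(* Main.v *)
Require Import Defs.
From HB Require Import structures.
From mathcomp Require Import all_boot all_order all_algebra.
From mathcomp Require Import sesquilinear complex.
From mathcomp Require Import all_classical all_reals all_analysis.
From mathcomp Require Import ring lra.

(* Since p n >= 3/2 eventually, a functional on E that stayed large far out would
   be too large on sums of disjointly supported vectors; hence it is small on
   tails. Together with the finite dimension of the blocks this makes E
   reflexive, which provides the weak limits, the projection P and the
   completeness of E. For a weakly null family the initial segments tend to 0 in
   norm, so it may be replaced by its tails without changing its class. A tail
   is asymptotically disjoint from any fixed x, whence
   Theta_U (x + h) = Theta x + Theta_U h, and far out t^(p n) is close to t^2,
   whence Theta_U (t h) = t^2 Theta_U h on the kernel; a modular that is
   2-homogeneous is the square of its Luxemburg norm. Finally, a(E_n) -> 1 and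
   p n -> 2 give a parallelogram inequality with constant tending to 2 on the
   blocks, hence the parallelogram law on the kernel, and the Jordan-von Neumann
   theorem makes it a Hilbert space. *)

Set Implicit Arguments.
Unset Strict Implicit.
Unset Printing Implicit Defensive.
Import Order.TTheory GRing.Theory Num.Theory.
Import numFieldNormedType.Exports.

Local Open Scope classical_set_scope.
Local Open Scope ring_scope.

(** * Norms and scalar limits *)

(** Finitely many exponents may equal 1 and the blocks carry arbitrary norms, so E need not be
    uniformly convex; reflexivity is proved by hand. On functionals that factor through a
    truncation, an element of the bidual is evaluation at a vector, and smallness on tails makes
    these functionals dense in the dual. The modular is in general neither homogeneous nor additive,
    but convexity makes it Lipschitz on bounded sets. This allows a class to be represented freely
    and x to be replaced by a truncation, whose support is exactly disjoint from the tails of a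
    family. On the kernel only upper estimates are proved. The scaling bound, used with a factor t
    and with its inverse, encloses the modular of h between squares of numbers on either side of the
    norm of h, and the parallelogram law likewise comes from an inequality. *)

Section RealNormTopology.
Variables (R : realType) (k : scalar_kind).
Local Notation K := (scalar_field R k).

Lemma of_real_gt0 (e : R) : (0 < of_real e :> K) = (0 < e).
Proof. by rewrite -(rmorph0 of_real) ltr_of_real. Qed.

Lemma re_of_real1 : re (1 : K) = 1.
Proof. by rewrite -(rmorph1 of_real) of_realK. Qed.

Lemma re_norm_of_real (t : R) : 0 <= t -> re `|of_real t : K| = t.
Proof. by move=> t0; rewrite normr_of_real// of_realK. Qed.

Lemma re_le_norm (z : K) : re z <= re `|z|.
Proof.
case: k z => [z|[a b]]; first exact: ler_norm.
apply: le_trans (ler_norm a) _.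
rewrite -sqrtr_sqr [leRHS](congr1 (@complex.Re R) (normc_def (a +i* b)%C)).
by rewrite ler_sqrt ?lerDl ?addr_ge0 ?sqr_ge0.
Qed.

Lemma norm_lt_rnorm (V : normedModType K) (x : V) (e : R) :
  (`|x| < of_real e) = (rnorm x < e).
Proof. by rewrite -of_real_rnorm ltr_of_real. Qed.

(** The library takes its epsilon in K; a positive element of K is real, so [re] and [of_real] carry
    it to a real epsilon and back. *)
Lemma cvg_rnormP (V : normedModType K) (T : Type) (F : set_system T)
    (FF : Filter F) (f : T -> V) (l : V) :
  (f x @[x --> F] --> l) <->
  (forall e : R, 0 < e -> \forall x \near F, rnorm (f x - l) < e).
Proof.
split=> [/cvgrPdist_lt fl e e0|fl].
  have := fl (of_real e); rewrite of_real_gt0 => /(_ e0).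
  by apply: filterS => x; rewrite distrC norm_lt_rnorm.
apply/cvgrPdist_lt => e e0; have := fl _ (re_gt0 e0).
by apply: filterS => x; rewrite distrC -norm_lt_rnorm reK// ltW.
Qed.

Lemma cvg_rnorm0P (V : normedModType K) (T : Type) (F : set_system T)
    (FF : Filter F) (f : T -> V) (l : V) :
  (f x @[x --> F] --> l) <-> (rnorm (f x - l) @[x --> F] --> (0 : R)).
Proof.
rewrite cvg_rnormP; split=> [fl|/cvgrPdist_lt fl e e0].
  apply/cvgrPdist_lt => e /fl; apply: filterS => x.
  by rewrite sub0r normrN ger0_norm ?rnorm_ge0.
have := fl e e0; apply: filterS => x.
by rewrite sub0r normrN ger0_norm ?rnorm_ge0.
Qed.

Lemma rnorm_sum (V : normedModType K) (I : Type) (r : seq I) (P : pred I) (F : I -> V) :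
  rnorm (\sum_(i <- r | P i) F i) <= \sum_(i <- r | P i) rnorm (F i).
Proof.
elim/big_ind2 : _ => // [|x a y b ha hb]; first by rewrite rnorm0.
by rewrite (le_trans (rnormD _ _))// lerD.
Qed.

Lemma rnorm_le_sub (V : normedModType K) (x y : V) :
  rnorm x <= rnorm y + rnorm (x - y).
Proof. by have := rnormD y (x - y); rewrite addrC subrK. Qed.

Lemma lipschitz_linear_continuous (V W : normedModType K) (f : V -> W) (C : R) :
  (forall x y, f (x - y) = f x - f y) -> (forall x, rnorm (f x) <= C * rnorm x) ->
  continuous f.
Proof.
move=> fB fC x; apply/cvg_rnormP => e e0.
have C1 : 0 < `|C| + 1 by have := normr_ge0 C; lra.
have /cvg_rnormP/(_ (e / (`|C| + 1)) (divr_gt0 e0 C1)) : y @[y --> x] --> x by [].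
apply: filterS => y; rewrite ltr_pdivlMr// => hy.
rewrite -fB; apply: le_lt_trans (fC _) _.
have := ler_norm C; have := rnorm_ge0 (y - x); nra.
Qed.

Section Dual.
Variable V : normedModType K.

Lemma cont_dual_exists (f : V -> K^o) (C : R) : (forall a x y, f (a *: x + y) = a *: f x + f y) ->
  (forall x, rnorm (f x) <= C * rnorm x) -> exists g : cont_dual V, forall x, g x = f x.
Proof.
move=> fl fC; suff fP : f \in dual_pred (V:=V) by exists (ContDual fP).
apply/asboolP; split; first exact: fl.
apply: lipschitz_linear_continuous fC => x y.
by rewrite addrC -scaleN1r fl scaleN1r addrC.
Qed.

Lemma dualD (f : cont_dual V) x y : f (x + y) = f x + f y.
Proof. by have := dual_linear f 1 x y; rewrite !scale1r. Qed.

Lemma dualB (f : cont_dual V) x y : f (x - y) = f x - f y.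
Proof. by rewrite addrC -scaleN1r dual_linear scaleN1r addrC. Qed.

Lemma dual_sum (f : cont_dual V) (I : Type) (r : seq I) (P : pred I) (F : I -> V) :
  f (\sum_(i <- r | P i) F i) = \sum_(i <- r | P i) f (F i).
Proof. by elim/big_ind2 : _ => [|x a y b <- <-|//]; rewrite ?dual0 ?dualD. Qed.

Lemma rnorm_dual (f : cont_dual V) : rnorm f = dual_norm f.
Proof. by rewrite /rnorm of_realK. Qed.

Lemma dual_le (f : cont_dual V) x : rnorm (f x) <= rnorm f * rnorm x.
Proof.
have [->|x0] := eqVneq x 0; first by rewrite dual0 !rnorm0 mulr0.
have nx0 := rnorm_gt0 x0.
rewrite rnorm_dual -ler_pdivrMr// mulrC.
have := @dual_norm_ub _ _ _ f (of_real (rnorm x)^-1 *: x).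
rewrite dualZ !rnormZ re_norm_of_real ?invr_ge0 ?rnorm_ge0//.
by rewrite mulVf ?gt_eqF//; apply.
Qed.

Lemma dual_le_bound (f : cont_dual V) (C : R) : 0 <= C ->
  (forall x, rnorm (f x) <= C * rnorm x) -> rnorm f <= C.
Proof.
move=> C0 h; rewrite rnorm_dual; apply: dual_norm_le => x x1.
by rewrite (le_trans (h x))// ler_piMr.
Qed.

End Dual.

End RealNormTopology.

Section UltraLimits.
Variables (R : realType) (k : scalar_kind).
Local Notation K := (scalar_field R k).
Variables (I : Type) (U : ultrafilter I).

Lemma scalar_bounded_cvg (g : I -> K^o) (M : R) : (forall i, rnorm (g i) <= M) ->
  exists l : K^o, g i @[i --> ultra_sets U] --> l.
Proof.
have real_lim (h : I -> R) : (forall i, `|h i| <= M) ->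
    exists l : R, h i @[i --> ultra_sets U] --> l.
  move=> hM; have /cvg_ex[l hl] := ultra_bounded_cvg (U := U) hM.
  by exists l.
case: k g => g gM; first exact: real_lim.
have nE (z : (scalar_field R ComplexScalars)^o) :
    rnorm z = Num.sqrt (complex.Re z ^+ 2 + complex.Im z ^+ 2).
  exact: (congr1 (@complex.Re R) (normc_def z)).
have reM i : `|complex.Re (g i)| <= M.
  apply: le_trans (gM i); rewrite nE -sqrtr_sqr ler_sqrt ?lerDl ?sqr_ge0//.
  by rewrite addr_ge0 ?sqr_ge0.
have imM i : `|complex.Im (g i)| <= M.
  apply: le_trans (gM i); rewrite nE -sqrtr_sqr ler_sqrt ?lerDr ?sqr_ge0//.
  by rewrite addr_ge0 ?sqr_ge0.
have [a ga] := real_lim _ reM; have [b gb] := real_lim _ imM.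
exists (a +i* b)%C; apply/(@cvg_rnormP R ComplexScalars) => e e0.
have e2 : 0 < e / 2 by lra.
move/cvgrPdist_lt: ga => /(_ _ e2) ga; move/cvgrPdist_lt: gb => /(_ _ e2) gb.
near=> i.
have h1 : `|a - complex.Re (g i)| < e / 2 by near: i.
have h2 : `|b - complex.Im (g i)| < e / 2 by near: i.
rewrite nE; case: (g i) h1 h2 => x y /= h1 h2.
rewrite -ltr_sqr ?nnegrE ?sqrtr_ge0 ?(ltW e0)// sqr_sqrtr ?addr_ge0 ?sqr_ge0//.
have : (x - a) ^+ 2 = `|a - x| ^+ 2 by rewrite real_normK ?num_real//; ring.
have : (y - b) ^+ 2 = `|b - y| ^+ 2 by rewrite real_normK ?num_real//; ring.
by move=> -> ->; have := normr_ge0 (a - x); have := normr_ge0 (b - y); nra.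
Unshelve. all: by end_near. Qed.

End UltraLimits.

(** * The Hahn-Banach theorem *)

Section HahnBanach.
Variables (R : realType) (k : scalar_kind).
Local Notation K := (scalar_field R k).

Section Sublinear.
Variable V : lmodType K.
Implicit Types q p : V -> R.

(** Only real scalars occur, so a space over either field is treated as a real one. The homogeneity
    inequality for t and for its inverse gives equality. *)
Definition sublinear q : Prop :=
  (forall x y, q (x + y) <= q x + q y) /\
  (forall (t : R) x, 0 < t -> q (of_real t *: x) <= t * q x).

Lemma sublinearZ q (t : R) x : sublinear q -> 0 < t -> q (of_real t *: x) = t * q x.
Proof.
move=> [_ qZ] t0; apply/eqP; rewrite eq_le qZ//=.
have := qZ t^-1 (of_real t *: x); rewrite invr_gt0 => /(_ t0).
by rewrite scalerA -rmorphM mulVf ?gt_eqF// rmorph1 scale1r ler_pdivlMl.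
Qed.

Lemma sublinear0 q : sublinear q -> q 0 = 0.
Proof.
by move=> /sublinearZ/(_ (ltr0Sn _ 1))-/(_ 0); rewrite scaler0; lra.
Qed.

Lemma sublinearN q x : sublinear q -> - q (- x) <= q x.
Proof.
move=> qs; have := qs.1 x (- x); rewrite subrr sublinear0//; lra.
Qed.

(** Its infimum over t is a sublinear functional below q whose value at - x is at most - q x, as t =
    1 shows; q itself only satisfies the opposite inequality there. *)
Definition shift_set q x y : set R :=
  [set r | exists2 t : R, 0 <= t & r = q (y + of_real t *: x) - t * q x].
Definition shift q x y : R := inf (shift_set q x y).

Lemma shift_has_inf q x y : sublinear q -> has_inf (shift_set q x y).
Proof.
move=> qs; split.
  by exists (q y), 0 => //; rewrite rmorph0 scale0r addr0 mul0r subr0.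
(* A bound uniform in t: t q x = q (t x) is at most q (y + t x) + q (- y). *)
exists (- q (- y)) => _ [t t0 ->].
have tx : q (of_real t *: x) = t * q x.
  move: t0; rewrite le_eqVlt => /orP[/eqP<-|/sublinearZ->//].
  by rewrite rmorph0 scale0r sublinear0// mul0r.
have := qs.1 (y + of_real t *: x) (- y); rewrite addrAC subrr add0r tx; lra.
Qed.

Lemma shift_le q x y (t : R) : sublinear q -> 0 <= t ->
  shift q x y <= q (y + of_real t *: x) - t * q x.
Proof.
by move=> qs t0; apply: ge_inf; [exact: (shift_has_inf x y qs).2|exists t].
Qed.

Lemma shift_le0 q x y : sublinear q -> shift q x y <= q y.
Proof.
move=> /shift_le/(_ (lexx 0))-/(_ x y).
by rewrite rmorph0 scale0r addr0 mul0r subr0.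
Qed.

Lemma shift_sublinear q x : sublinear q -> sublinear (shift q x).
Proof.
move=> qs; split=> [y z|t y t0]; apply/ler_addgt0Pr => e e0.
  have [_ [s s0 ->] hs] := inf_adherent (divr_gt0 e0 (ltr0Sn _ 1)) (shift_has_inf x y qs).
  have [_ [t t0 ->] ht] := inf_adherent (divr_gt0 e0 (ltr0Sn _ 1)) (shift_has_inf x z qs).
  apply: le_trans (shift_le _ _ qs (addr_ge0 s0 t0)) _.
  have := qs.1 (y + of_real s *: x) (z + of_real t *: x).
  rewrite addrACA -scalerDl -rmorphD => h.
  by rewrite -!/(shift _ _ _) in hs ht; lra.
have et : 0 < e / t by rewrite divr_gt0.
have [_ [s s0 ->] hs] := inf_adherent et (shift_has_inf x y qs).
apply: le_trans (shift_le _ _ qs (mulr_ge0 (ltW t0) s0)) _.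
rewrite rmorphM -scalerA -scalerDr sublinearZ// -/(shift _ _ _) in hs *.
have -> : t * shift q x y + e = t * (shift q x y + e / t).
  by field; rewrite gt_eqF.
by rewrite -mulrA -mulrBr ler_pM2l// ltW.
Qed.

(* Koenig's proof: a minimal sublinear functional q equals each of its
   shifts, which forces it to be additive. *)
Lemma minimal_sublinear q : sublinear q ->
  (forall q', sublinear q' -> (forall x, q' x <= q x) -> q' = q) ->
  (forall x y, q (x + y) = q x + q y) /\ (forall (t : R) x, q (of_real t *: x) = t * q x).
Proof.
move=> qs qmin.
have qD x y : q (x + y) = q x + q y.
  apply/eqP; rewrite eq_le qs.1/=.
  have e : shift q y = q.
    by apply: qmin => [|z]; [exact: shift_sublinear|exact: shift_le0].
  by have := shift_le y x qs ler01; rewrite e rmorph1 scale1r mul1r; lra.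
have qN x : q (- x) = - q x.
  by have := qD x (- x); rewrite subrr sublinear0//; lra.
split=> // t x; have [t0|t0|->] := ltgtP t 0.
- rewrite -[t]opprK rmorphN scaleNr qN sublinearZ ?oppr_gt0//; lra.
- exact: sublinearZ.
- by rewrite rmorph0 scale0r sublinear0// mul0r.
Qed.

(** Zorn's lemma for the reversed pointwise order. A nonempty chain is bounded by its pointwise
    infimum, which is finite because each member is at least - p (- x) at x, and subadditive because
    two members that nearly attain it at x and at y are comparable. *)
Lemma exists_minimal_sublinear p : sublinear p -> exists q, [/\ sublinear q,
  forall x, q x <= p x
  & forall q', sublinear q' -> (forall x, q' x <= q x) -> q' = q].
Proof.
move=> ps.
pose T := {q : V -> R | sublinear q /\ forall x, q x <= p x}.
pose Rel (q q' : T) : bool := `[< forall x, sval q' x <= sval q x >].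
have [|||A Atot|[q [qs qp]] qmin] := @Zorn T Rel.
- by move=> q; apply/asboolP.
- move=> q r s /asboolP qr /asboolP rs; apply/asboolP => x.
  exact: le_trans (rs x) (qr x).
- move=> [q hq] [r hr] /asboolP/= qr /asboolP/= rq; apply: eq_exist.
  by apply/funext => x; apply/eqP; rewrite eq_le qr rq.
- have [[a Aa]|A0] := pselect (exists a, A a); last first.
    exists (exist _ p (conj ps (fun x => lexx (p x)))) => s As.
    by case: A0; exists s.
  pose S x := [set sval q x | q in A].
  have Sinf x : has_inf (S x).
    split; first by exists (sval a x), a.
    exists (- p (- x)) => _ [[q [qs qp]] Aq <-] /=.
    by have := sublinearN x qs; have := qp (- x); lra.
  pose m x := inf (S x).
  have mle x (s : T) : A s -> m x <= sval s x.
    by move=> As; apply: ge_inf; [exact: (Sinf x).2|exists s].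
  have ms : sublinear m.
    split=> [x y|t x t0]; apply/ler_addgt0Pr => e e0.
      have [_ [q Aq <-] hq] := inf_adherent (divr_gt0 e0 (ltr0Sn _ 1)) (Sinf x).
      have [_ [r Ar <-] hr] := inf_adherent (divr_gt0 e0 (ltr0Sn _ 1)) (Sinf y).
      rewrite -/(m x) in hq; rewrite -/(m y) in hr.
      have [s As [sx sy]] : exists2 s, A s & sval s x <= sval q x /\ sval s y <= sval r y.
        have [/asboolP h|/asboolP h] := Atot _ _ Aq Ar.
          by exists r.
        by exists q.
      have := mle (x + y) _ As; have := (svalP s).1.1 x y; lra.
    have et : 0 < e / t by rewrite divr_gt0.
    have [_ [q Aq <-] hq] := inf_adherent et (Sinf x).
    apply: le_trans (mle _ _ Aq) _; rewrite sublinearZ//; last exact: (svalP q).1.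
    have -> : t * m x + e = t * (m x + e / t) by field; rewrite gt_eqF.
    by rewrite ler_pM2l// ltW.
  have mp x : m x <= p x by apply: le_trans (mle _ _ Aa) _; exact: (svalP a).2.
  exists (exist _ m (conj ms mp)) => s As; apply/asboolP => x /=; exact: mle.
exists q; split=> // q' q's q'q.
have q'p x : q' x <= p x by exact: le_trans (q'q x) (qp x).
by have /(congr1 sval) := qmin (exist _ q' (conj q's q'p)) (asboolT q'q).
Qed.

(** Minimizing below the shift of p along y, rather than below p, forces equality at y: the shift is
    at most - p y at - y, so the additive g satisfies g y >= p y. *)
Lemma hahn_banach p y : sublinear p -> exists g : V -> R,
  [/\ forall x z, g (x + z) = g x + g z, forall (t : R) x, g (of_real t *: x) = t * g x,
      forall x, g x <= p x & g y = p y].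
Proof.
move=> ps; have [g [gs gp gmin]] := exists_minimal_sublinear (shift_sublinear y ps).
have [gD gZ] := minimal_sublinear gs gmin.
have gle x : g x <= p x by exact: le_trans (gp x) (shift_le0 y x ps).
exists g; split=> //; apply/eqP; rewrite eq_le gle/=.
have := shift_le y (- y) ps ler01; rewrite rmorph1 scale1r mul1r addNr sublinear0//.
have := gp (- y); have := gD y (- y); rewrite subrr sublinear0//; lra.
Qed.

End Sublinear.

(** Over the complex numbers this is the Bohnenblust-Sobczyk formula f x = g x - i g (i x). *)
Lemma scalar_re_extension (V : lmodType K) (g : V -> R) :
  (forall x z, g (x + z) = g x + g z) -> (forall (t : R) x, g (of_real t *: x) = t * g x) ->
  exists f : V -> K^o, (forall a x y, f (a *: x + y) = a *: f x + f y) /\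
    forall x, re (f x) = g x.
Proof.
case: k V g => V g gD gZ; first by exists g; split=> // a x y; rewrite gD gZ.
exists (fun x => (g x +i* - g ('i%C *: x))%C); split=> // -[a b] x y.
have gZC (c d : R) z : g ((c +i* d)%C *: z) = c * g z + d * g ('i%C *: z).
  have -> : (c +i* d)%C = c%:C%C + d%:C%C * 'i%C :> R[i] by simpc.
  by rewrite scalerDl -scalerA gD !gZ.
apply/eqP; rewrite eq_complex/= scalerDr !gD scalerA.
have -> : ('i * (a +i* b))%C = (- b +i* a)%C :> R[i] by simpc.
rewrite (gZC a b) (gZC (- b) a); apply/andP; split; apply/eqP; ring.
Qed.

Lemma norming_functional (V : normedModType K) (y : V) : exists f : cont_dual V,
  (forall x, rnorm (f x) <= rnorm x) /\ re (f y) = rnorm y.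
Proof.
have ns : sublinear (@rnorm R k V).
  by split=> [|t x t0]; [exact: rnormD|rewrite rnormZ re_norm_of_real// ltW].
have [g [gD gZ gle gy]] := hahn_banach y ns.
have [f [fl fg]] := scalar_re_extension gD gZ.
have fle x : rnorm (f x) <= 1 * rnorm x.
  rewrite mul1r; have [->|f0] := eqVneq (f x) 0; first by rewrite rnorm0 rnorm_ge0.
  have fZ a : f (a *: x) = a *: f x.
    have := fl a x 0; rewrite addr0 => ->.
    have := fl 1 0 0; rewrite !scale1r addr0 -[X in X = _]addr0 => /addrI <-.
    by rewrite addr0.
  (* Rotating x by the unimodular u makes f (u x) equal to the modulus of f x, so the one-sided
     bound on the real part g bounds f itself. *)
  pose u : K := `|f x| / f x.
  have u1 : `|u| = 1 by rewrite normf_div normr_id divff ?normr_eq0.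
  have := gle (u *: x); rewrite rnormZ u1 re_of_real1 mul1r -fg fZ.
  by rewrite [_ *: _]divfK.
have [h hf] := cont_dual_exists fl fle.
by exists h; split=> [x|]; rewrite hf ?fg//; have := fle x; rewrite mul1r.
Qed.

Lemma dual_separates (V : normedModType K) (x y : V) :
  (forall f : cont_dual V, f x = f y) -> x = y.
Proof.
move=> h; apply/eqP; rewrite -subr_eq0; apply/eqP/rnorm0_eq0.
by have [f [_ <-]] := norming_functional (x - y); rewrite dualB h subrr raddf0.
Qed.

End HahnBanach.

(** * Finite-dimensional spaces and inner products *)

Section FiniteDimensional.
Variables (R : realType) (k : scalar_kind).
Local Notation K := (scalar_field R k).
Variable V : normedModType K.

(* T v = \sum_(e <- l) e.2 v *: e.1 is a projection that fixes the vectors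
   treated so far; a new vector b adds its component b - T b. *)
Lemma dual_system (s : seq V) : exists l : seq (V * cont_dual V),
  let T (v : V) : V := \sum_(e <- l) (e.2 v : K) *: e.1 in
  (forall v, T (T v) = T v) /\ forall b, b \in s -> T b = b.
Proof.
elim: s => [|b s [l [TT0 Ts0]]]; first by exists [::]; split=> // v; rewrite !big_nil.
have [T TE] : exists T : V -> V, forall v, T v = \sum_(e <- l) (e.2 v : K) *: e.1.
  by exists (fun v => \sum_(e <- l) (e.2 v : K) *: e.1).
have TT v : T (T v) = T v by rewrite !TE; exact: TT0.
have Ts c : c \in s -> T c = c by rewrite TE; exact: Ts0.
have TL a x y : T (a *: x + y) = a *: T x + T y.
  rewrite !TE scaler_sumr -big_split/=; apply: eq_bigr => e _.
  by rewrite dual_linear scalerDl scalerA.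
have TB x y : T (x - y) = T x - T y.
  by rewrite addrC -scaleN1r TL scaleN1r addrC.
have [Tb|r0] := eqVneq (b - T b) 0.
  exists l; split=> // c; rewrite inE => /orP[/eqP->|]; last exact: Ts0.
  by rewrite -TE; apply/esym/eqP; rewrite -subr_eq0 Tb.
set r := b - T b in r0.
have [g0 [_ gr]] := norming_functional r.
have gr0 : g0 r != 0.
  by apply: contraTneq (rnorm_gt0 r0) => h; rewrite -gr h raddf0 ltxx.
have [C hC] : exists C : R, forall v, rnorm (T v) <= C * rnorm v.
  exists (\sum_(e <- l) rnorm e.2 * rnorm e.1) => v.
  rewrite TE; apply: le_trans (rnorm_sum _ _ _) _; rewrite mulr_suml; apply: ler_sum => e _.
  rewrite rnormZ mulrAC ler_wpM2r ?rnorm_ge0//; exact: dual_le.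
(* Composition with id - T makes g vanish on the range of T, and the factor makes g r = 1; together
   with T r = 0 this keeps the enlarged map idempotent. *)
have [g hg] : exists g : cont_dual V, forall v, g v = (g0 r)^-1 *: g0 (v - T v).
  apply: (@cont_dual_exists _ _ _ _ (rnorm ((g0 r)^-1 : K^o) * (rnorm g0 * (1 + C)))).
    move=> a x y; rewrite TL opprD addrACA -scalerBr dual_linear scalerDr !scalerA.
    by rewrite [_ * a]mulrC.
  move=> v; rewrite rnormZ -!mulrA ler_wpM2l ?re_ge0//.
  apply: le_trans (dual_le _ _) _; rewrite ler_wpM2l ?rnorm_ge0// mulrDl mul1r.
  by apply: le_trans (rnormD _ _) _; rewrite rnormN lerD2l.
have Tr : T r = 0 by rewrite /r TB TT subrr.
have g1 : g r = 1 by rewrite hg Tr subr0 [_ *: _]mulVf.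
have gT v : T v = v -> g v = 0 by move=> e; rewrite hg e subrr dual0 scaler0.
exists ((r, g) :: l).
have T'E v : \sum_(e <- (r, g) :: l) (e.2 v : K) *: e.1 = (g v : K) *: r + T v.
  by rewrite big_cons TE.
split=> [v|c]; rewrite !T'E.
  by rewrite dual_linear g1 [_ *: 1]mulr1 (gT (T v))// TL Tr scaler0 add0r TT addr0.
rewrite inE => /orP[/eqP->|cs]; last by rewrite gT Ts// scale0r add0r.
have -> : (g b : K) = 1 by rewrite hg; exact: mulVf.
by rewrite scale1r subrK.
Qed.

(** A projection that fixes a spanning family is the identity. The coordinates are continuous by
    construction, without recourse to the equivalence of norms. *)
Lemma finite_dual_basis : finite_dimensional V -> exists l : seq (V * cont_dual V),
  forall v, v = \sum_(e <- l) (e.2 v : K) *: e.1.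
Proof.
move=> [d [b hb]]; have [l [_ hl]] := dual_system [seq b i | i <- enum 'I_d].
exists l => v; have [c ->] := hb v.
under [RHS]eq_bigr do rewrite dual_sum scaler_suml.
rewrite exchange_big/=; apply: eq_bigr => i _.
rewrite -[in LHS](hl (b i)) ?map_f ?mem_enum// scaler_sumr.
by apply: eq_bigr => e _; rewrite dualZ scalerA.
Qed.

End FiniteDimensional.

(** * The Jordan-von Neumann theorem: an inner product from the parallelogram law *)

Section JordanVonNeumann.
Variables (R : realType).

(** Subtracting t f(1) leaves an additive g that vanishes on the integers; it has period 1 and is
    therefore bounded on the whole line. As g (n t) = n g t, it is zero. *)
Lemma additive_locally_bounded (f : R -> R) (C : R) :
  (forall s t, f (s + t) = f s + f t) -> (forall t, 0 <= t <= 1 -> `|f t| <= C) ->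
  forall t, f t = t * f 1.
Proof.
move=> fD fC.
pose g t := f t - t * f 1.
have gD s t : g (s + t) = g s + g t by rewrite /g fD; ring.
have g0 : g 0 = 0 by have := gD 0 0; rewrite addr0; lra.
have gn n t : g (n%:R * t) = n%:R * g t.
  elim: n => [|n IH]; first by rewrite !mul0r g0.
  by rewrite -natr1 !mulrDl !mul1r gD IH.
have gN t : g (- t) = - g t by have := gD t (- t); rewrite subrr g0; lra.
have g1 : g 1 = 0 by rewrite /g mul1r subrr.
have gnat n : g n%:R = 0 by have := gn n 1; rewrite mulr1 g1 mulr0.
have gz (z : int) : g z%:~R = 0 by case: z => n; rewrite ?NegzE ?mulrNz ?gN gnat ?oppr0.
have gB t : `|g t| <= C + `|f 1|.
  have -> : g t = g (t - (Num.floor t)%:~R) by rewrite gD gN gz subr0.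
  have := Num.Theory.floor_le t; have := Num.Theory.floorD1_gt t; rewrite intrD.
  set s := t - _ => h1 h2; have s01 : 0 <= s <= 1 by rewrite /s; apply/andP; split; lra.
  rewrite /g (le_trans (ler_normB _ _))// lerD ?fC// normrM ger0_norm; last by case/andP: s01.
  by rewrite ler_piMl//; case/andP: s01.
move=> t; apply/eqP; rewrite -subr_eq0 -/(g t); apply/negPn/negP => gt0.
have gp : 0 < `|g t| by rewrite normr_gt0.
have Cp : 0 <= C + `|f 1| by exact: le_trans (gB t).
have := Num.Theory.archi_boundP (divr_ge0 Cp (ltW gp)).
set n := Num.bound _; rewrite ltr_pdivrMr// => h.
by have := gB (n%:R * t); rewrite gn normrM normr_nat leNgt h.
Qed.

Variable k : scalar_kind.
Local Notation K := (scalar_field R k).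
Variable V : normedModType K.
Hypothesis parallelogram : forall x y : V,
  rnorm (x + y) ^+ 2 + rnorm (x - y) ^+ 2 = 2 * (rnorm x ^+ 2 + rnorm y ^+ 2).

(** Polarization; over the complex numbers this yields the real part of the inner product. *)
Definition polar (x y : V) : R := (rnorm (x + y) ^+ 2 - rnorm (x - y) ^+ 2) / 4.

Lemma polarC x y : polar x y = polar y x.
Proof. by rewrite /polar (addrC x y) -(opprB x y) rnormN. Qed.

Lemma polarNl x y : polar (- x) y = - polar x y.
Proof.
have -> : polar (- x) y = (rnorm (- (x - y)) ^+ 2 - rnorm (- (x + y)) ^+ 2) / 4.
  by rewrite /polar !opprD opprK.
by rewrite !rnormN /polar; lra.
Qed.

Lemma polarDl x y z : polar (x + y) z = polar x z + polar y z.
Proof.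
(* The difference of the parallelogram laws for the pairs (a + c, b + c) and (a - c, b - c). The
   case b = 0 then removes the doubling of c. *)
have half a b c : 2 * (polar a c + polar b c) = polar (a + b) (c + c).
  have := parallelogram (a + c) (b + c); have := parallelogram (a - c) (b - c).
  rewrite /polar.
  rewrite (_ : a - c + (b - c) = a + b - (c + c)); last by rewrite opprD addrACA.
  rewrite (_ : a - c - (b - c) = a - b); last by rewrite opprB addrA subrK.
  rewrite (_ : a + c + (b + c) = a + b + (c + c)); last by rewrite addrACA.
  rewrite (_ : a + c - (b + c) = a - b); last by rewrite opprD addrACA subrr addr0.
  lra.
have p0 c : polar 0 c = 0 by rewrite /polar sub0r rnormN add0r subrr mul0r.
have dbl a c : polar a (c + c) = 2 * polar a c by have := half a 0 c; rewrite p0 !addr0.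
by have := half x y z; rewrite dbl; lra.
Qed.

(** As a function of t the left side is additive and bounded on [0, 1], hence linear. *)
Lemma polarZl (t : R) x y : polar (of_real t *: x) y = t * polar x y.
Proof.
have := @additive_locally_bounded (fun t => polar (of_real t *: x) y)
  ((rnorm x + rnorm y) ^+ 2).
rewrite rmorph1 scale1r; apply=> {t}[s t|t /andP[t0 t1]].
  by rewrite rmorphD scalerDl polarDl.
have b (z : V) : rnorm z <= rnorm x + rnorm y ->
    0 <= rnorm z ^+ 2 <= (rnorm x + rnorm y) ^+ 2.
  move=> h; rewrite sqr_ge0/= ler_sqr ?nnegrE ?addr_ge0 ?rnorm_ge0//.
have tx : rnorm (of_real t *: x) <= rnorm x.
  by rewrite rnormZ re_norm_of_real// ler_piMl// rnorm_ge0.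
have /andP[a1 a2] : 0 <= rnorm (of_real t *: x + y) ^+ 2 <= (rnorm x + rnorm y) ^+ 2.
  by apply: b; apply: le_trans (rnormD _ _) _; rewrite lerD2r.
have /andP[b1 b2] : 0 <= rnorm (of_real t *: x - y) ^+ 2 <= (rnorm x + rnorm y) ^+ 2.
  by apply: b; apply: le_trans (rnormD _ _) _; rewrite rnormN lerD2r.
by rewrite /polar ler_norml; apply/andP; split; lra.
Qed.

Lemma polarxx x : polar x x = rnorm x ^+ 2.
Proof.
rewrite /polar subrr rnorm0 -[x + x]mulr2n -scaler_nat.
rewrite (_ : 2%:R = of_real 2 :> K); last by rewrite rmorph_nat.
by rewrite rnormZ re_norm_of_real//; field.
Qed.

End JordanVonNeumann.

Section InnerProduct.
Variables (R : realType) (k : scalar_kind).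
Local Notation K := (scalar_field R k).

Lemma inner_product_exists (V : normedModType K) :
  (forall x y : V,
    rnorm (x + y) ^+ 2 + rnorm (x - y) ^+ 2 = 2 * (rnorm x ^+ 2 + rnorm y ^+ 2)) ->
  exists F : V -> V -> K, [/\ forall x y z, F (x + y) z = F x z + F y z,
    forall a x y, F (a *: x) y = a * F x y, forall x y, F x y = conj_scalar (F y x)
    & forall x, F x x = `|x| ^+ 2].
Proof.
move=> P; pose B := @polar R k V.
have BD := polarDl P; have BZ := polarZl P; rewrite -/B in BD BZ.
have BC : forall x y, B x y = B y x by exact: polarC.
have Bx : forall x, B x x = rnorm x ^+ 2 by exact: polarxx.
have BN : forall x y, B (- x) y = - B x y by exact: polarNl.
have nE (x : V) : of_real (rnorm x ^+ 2) = `|x| ^+ 2 by rewrite rmorphXn/= of_real_rnorm.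
have Bu (u : K) x y : `|u| = 1 -> B (u *: x) (u *: y) = B x y.
  by move=> u1; rewrite /B /polar -scalerDr -scalerBr !rnormZ u1 re_of_real1 !mul1r.
move: {P} B BD BZ BC Bx BN nE Bu; case: k V => V B BD BZ BC Bx BN nE Bu.
  by exists B; split=> // x; rewrite Bx -nE.
have i1 : `|'i%C : R[i]| = 1 by exact: normCi.
have Bi x y : B ('i%C *: x) y = - B x ('i%C *: y).
  by rewrite -(Bu 'i%C _ _ i1) scalerA -expr2 sqr_i scaleN1r BN.
(* The form is conjugate linear in its second argument, so the imaginary part of its value at (x, y)
   is the real part of its value at (x, i y). *)
exists (fun x y => (B x y +i* B x ('i%C *: y))%C); split.
- by move=> x y z; rewrite !BD.
- move=> [a b] x y.
  have gZC (c d : R) w z : B ((c +i* d)%C *: z) w = c * B z w + d * B ('i%C *: z) w.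
    have -> : (c +i* d)%C = c%:C%C + d%:C%C * 'i%C :> R[i] by simpc.
    by rewrite scalerDl -scalerA BD !BZ.
  apply/eqP; rewrite eq_complex/= (gZC a b y x) (gZC a b ('i%C *: y) x) !Bi.
  rewrite scalerA -expr2 sqr_i scaleN1r [B x (- y)]BC BN (BC y x).
  by apply/andP; split; apply/eqP; ring.
- by move=> x y; apply/eqP; rewrite eq_complex/= (BC y x) eqxx -Bi BC eqxx.
- move=> x; rewrite -nE -Bx /=; congr (_ +i* _)%C.
  by have := Bi x x; rewrite BC; lra.
Qed.

Lemma hilbert_of_parallelogram (G : completeNormedModType K) :
  (forall x y : G,
    rnorm (x + y) ^+ 2 + rnorm (x - y) ^+ 2 = 2 * (rnorm x ^+ 2 + rnorm y ^+ 2)) ->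
  hilbert_space G.
Proof.
move=> /inner_product_exists[F [FD FZ FC Fx]].
have FDr x : zmod_morphism (F x).
  move=> y z; rewrite FC (FC x y) (FC x z) -rmorphB.
  by rewrite FD -scaleN1r FZ mulN1r.
have FDl y : zmod_morphism (F ^~ y).
  by move=> x z; rewrite FD -scaleN1r FZ mulN1r.
have FZr x : scalable_for (conj_scalar \; *%R) (F x).
  by move=> a y; rewrite FC FZ rmorphM -FC.
have FZl y : scalable_for *%R (F ^~ y) by move=> a x; exact: FZ.
(* The exponent [false] selects the sign of Hermitian, as opposed to skew-Hermitian, forms. *)
have FC' x y : F x y = (-1) ^+ false * conj_scalar (F y x) by rewrite mul1r.
have Fpos x : x != 0 -> 0 < F x x by move=> x0; rewrite Fx exprn_gt0// normr_gt0.
pose M1 := isBilinear.Build K G G K *%R (conj_scalar \; *%R) F FDl FDr FZl FZr.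
pose M2 := isHermitianSesquilinear.Build K G false conj_scalar F FC'.
pose M3 := isDotProduct.Build K G F Fpos.
pose D : {dot G for @conj_scalar R k} := HB.pack_for {dot G for @conj_scalar R k} F M1 M2 M3.
by exists D.
Qed.

End InnerProduct.

(** * Weak limits and completeness of ultrapowers *)

Section Limits.
Variables (R : realType) (k : scalar_kind).
Local Notation K := (scalar_field R k).

Lemma cvg_rnorm_le (V : normedModType K) (T : Type) (F : set_system T)
    (FF : ProperFilter F) (f : T -> V) (l : V) (C : R) :
  f x @[x --> F] --> l -> (\forall x \near F, rnorm (f x) <= C) -> rnorm l <= C.
Proof.
move=> /cvg_rnormP fl fC; apply/ler_addgt0Pr => e /fl fe.
have [x [h1 h2]] := @filter_ex _ F _ _ (filterI fC fe).
have := rnorm_le_sub l (f x); rewrite -(rnormN (l - _)) opprB.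
by move: h1 h2 => /=; lra.
Qed.

Lemma cvg_linear_comb (V : normedModType K) (T : Type) (F : set_system T)
    (FF : ProperFilter F) (a : K) (f g : T -> V) (l m : V) :
  f x @[x --> F] --> l -> g x @[x --> F] --> m ->
  a *: f x + g x @[x --> F] --> a *: l + m.
Proof. by move=> fl gm; apply: cvgD gm; exact: cvgZl_tmp. Qed.

Lemma cauchy_rnormP (V : normedModType K) (F : set_system V) (FF : ProperFilter F) :
  cauchy F <-> forall e : R, 0 < e -> exists a, \forall v \near F, rnorm (v - a) < e.
Proof.
rewrite cauchyP; split=> h e e0.
  have [|a Fa] := h (of_real e); first by rewrite of_real_gt0.
  exists a; apply: filterS Fa => v; rewrite -ball_normE/= distrC norm_lt_rnorm//.
have [a Fa] := h _ (re_gt0 e0); exists a; apply: filterS Fa => v.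
by rewrite -norm_lt_rnorm reK ?ltW// -ball_normE/= distrC.
Qed.

Lemma cauchy_seq_cvg (V : normedModType K) (u : nat -> V) (c : nat -> R) :
  banach_space V -> c n @[n --> \oo] --> (0 : R) ->
  (forall n m, rnorm (u (n + m)%N - u n) <= c n) ->
  exists l, forall n, rnorm (l - u n) <= c n.
Proof.
move=> Vb c0 uc.
have : cauchy (u n @[n --> \oo]).
  apply/cauchy_rnormP => e e0; move/cvgrPdist_lt: c0 => /(_ e e0)[N _ hN].
  exists (u N); exists N => // n /= Nn.
  have := hN N (leqnn N); rewrite /= sub0r normrN => h.
  by rewrite -(subnKC Nn); apply: le_lt_trans (uc _ _) _; apply: le_lt_trans (ler_norm _) h.
move=> uC; have /cvg_ex[l ul] : cvg (u n @[n --> \oo]) by exact: Vb.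
exists l => n.
have h : u m - u n @[m --> \oo] --> l - u n by apply: cvgB => //; exact: cvg_cst.
apply: cvg_rnorm_le h _; exists n => // m /= nm.
by rewrite -(subnKC nm).
Qed.

End Limits.

Section WeakLimits.
Variables (R : realType) (k : scalar_kind).
Local Notation K := (scalar_field R k).
Variable V : normedModType K.

Lemma weak_limit_unique (I : Type) (U : ultrafilter I) (x : I -> V) (l l' : V) :
  weak_limit U x l -> weak_limit U x l' -> l = l'.
Proof.
move=> xl xl'; apply: dual_separates => f.
exact: (cvg_unique _ (xl f) (xl' f)).
Qed.

(** Weak lower semicontinuity of the norm, tested on a functional that norms l - y. *)
Lemma weak_limit_le (I : Type) (U : ultrafilter I) (x : I -> V) (l y : V) (C : R) :
  weak_limit U x l -> (\forall i \near ultra_sets U, rnorm (x i - y) <= C) ->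
  rnorm (l - y) <= C.
Proof.
move=> xl xC; have [f [f1 <-]] := norming_functional (l - y).
have h : f (x i - y) @[i --> ultra_sets U] --> f (l - y).
  rewrite dualB; under eq_fun do rewrite dualB.
  by apply: cvgB; [exact: xl|exact: cvg_cst].
have : rnorm (f (l - y)) <= C.
  apply: cvg_rnorm_le h _; apply: filterS xC => i; exact/le_trans/f1.
by apply: le_trans; exact: re_le_norm.
Qed.

Lemma rnorm_weak_limit_le (I : Type) (U : ultrafilter I) (x : I -> V) (l : V) (C : R) :
  weak_limit U x l -> (\forall i \near ultra_sets U, rnorm (x i) <= C) -> rnorm l <= C.
Proof.
move=> xl xC; rewrite -[l]subr0; apply: weak_limit_le xl _.
by apply: filterS xC => i; rewrite subr0.
Qed.

(** The limit of f (x i) along U depends linearly on f and is bounded by M times the norm of f, so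
    it defines an element of the bidual; reflexivity represents it by a vector. *)
Lemma reflexive_weak_limit (I : Type) (U : ultrafilter I) (x : I -> V) (M : R) :
  reflexive_space V -> (forall i, rnorm (x i) <= M) -> exists l, weak_limit U x l.
Proof.
move=> Vr xM.
have fM (f : cont_dual V) i : rnorm (f (x i)) <= rnorm f * M.
  by apply: le_trans (dual_le _ _) _; rewrite ler_wpM2l ?rnorm_ge0.
have /choice[L fL] : forall f : cont_dual V, exists l : K^o, f (x i) @[i --> ultra_sets U] --> l.
  by move=> f; exact: scalar_bounded_cvg (fM f).
have [|f|phi hphi] := @cont_dual_exists R k (cont_dual V) L M.
- move=> a f g; have h : (a *: f + g) (x i) @[i --> ultra_sets U] --> (a *: L f + L g : K^o).
    exact: (@cvg_linear_comb R k K^o _ _ _ a _ _ _ _ (fL f) (fL g)).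
  exact: (cvg_unique _ (fL (a *: f + g)) h).
- by apply: cvg_rnorm_le (fL f) _; apply: filterE => i; rewrite mulrC.
by have [l hl] := Vr phi; exists l => f; rewrite -hl hphi.
Qed.

(** A Cauchy filter is refined to an ultrafilter on V itself, with the identity as family, cut off
    away from a to make it bounded everywhere. Lower semicontinuity of the norm turns the weak limit
    into a norm limit of the original filter. *)
Lemma banach_of_weak_limits :
  (forall (I : Type) (U : ultrafilter I) (x : I -> V) (M : R),
    (forall i, rnorm (x i) <= M) -> exists l, weak_limit U x l) -> banach_space V.
Proof.
move=> Vw F FF /cauchy_rnormP Fc.
have [a Fa] := Fc 1 ltr01.
have [G [GU FG]] := ultraFilterLemma FF.
pose U := Ultrafilter GU.
pose x v : V := if rnorm (v - a) < 1 then v else a.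
have xM v : rnorm (x v) <= rnorm a + 1.
  rewrite /x; case: ifPn => h; last by lra.
  by have := rnorm_le_sub v a; lra.
have [l xl] := Vw _ U x _ xM.
apply/cvg_ex; exists l; apply/(@cvg_rnormP _ _ _ _ _ FF id) => e e0.
have [b Fb] := Fc (e / 2) (divr_gt0 e0 (ltr0Sn _ 1)).
have lb : rnorm (l - b) <= e / 2.
  apply: weak_limit_le xl _.
  have : ultra_sets U [set v | rnorm (v - a) < 1 /\ rnorm (v - b) < e / 2].
    by apply: FG; exact: filterI.
  by apply: filterS => v [h1 h2]; rewrite /x h1 ltW.
apply: filterS Fb => v /= vb; have := rnormD (v - b) (b - l).
by rewrite addrA subrK -[b - l]opprB rnormN; lra.
Qed.

End WeakLimits.

Section UltrapowerComplete.
Variables (R : realType) (k : scalar_kind).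
Local Notation K := (scalar_field R k).
Variables (V : normedModType K) (I : Type) (U : ultrafilter I).

Lemma rnorm_ultrapower (q : ultrapower V U) : rnorm q = unorm q.
Proof. by rewrite /rnorm of_realK. Qed.

Lemma uclassB (x y : linfty V I) : uclass U (x - y) = uclass U x - uclass U y.
Proof. exact: raddfB. Qed.

Lemma rnorm_uclass (x : linfty V I) :
  rnorm (x i) @[i --> ultra_sets U] --> rnorm (uclass U x).
Proof. by rewrite rnorm_ultrapower; exact: unorm_class. Qed.

Lemma rnorm_uclass_le (x : linfty V I) (C : R) :
  (\forall i \near ultra_sets U, rnorm (x i) <= C) -> rnorm (uclass U x) <= C.
Proof. by move=> xC; exact: (cvgr_to_le (@rnorm_uclass x) xC). Qed.

Lemma rnorm_uclass_lt (x : linfty V I) (C : R) :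
  rnorm (uclass U x) < C -> \forall i \near ultra_sets U, rnorm (x i) < C.
Proof. by move=> xC; exact: (@cvgr_lt _ _ _ _ _ _ (@rnorm_uclass x) _ xC). Qed.

Lemma rnorm_uclass_gt (x : linfty V I) (C : R) :
  C < rnorm (uclass U x) -> \forall i \near ultra_sets U, C < rnorm (x i).
Proof. by move=> xC; exact: (@cvgr_gt _ _ _ _ _ _ (@rnorm_uclass x) _ xC). Qed.

Lemma uclass_near_eq (x y : linfty V I) :
  (\forall i \near ultra_sets U, x i = y i) -> uclass U x = uclass U y.
Proof.
move=> xy; apply/uclassP; apply/cvgrPdist_lt => e e0.
by apply: filterS xy => i /= ->; rewrite subrr rnorm0 subr0 normr0.
Qed.

Lemma linftyZ (a : K) (x : linfty V I) i : (a *: x) i = a *: x i.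
Proof. by []. Qed.

Lemma linftyD (x y : linfty V I) i : (x + y) i = x i + y i.
Proof. by []. Qed.

Lemma linftyB (x y : linfty V I) i : (x - y) i = x i - y i.
Proof. by []. Qed.

(* Representatives of a rapidly convergent sequence of classes can be
   corrected so that they converge uniformly on all of I. *)
Lemma ultrapower_complete : banach_space V -> banach_space (ultrapower V U).
Proof.
move=> Vb F FF /cauchy_rnormP Fc.
pose c n : R := 2^-1 ^+ n.
have c0 n : 0 < c n by rewrite exprn_gt0// invr_gt0.
have cS n : c n.+1 = c n / 2 by rewrite /c exprS mulrC.
have cc : c n @[n --> \oo] --> (0 : R).
  by apply: cvg_expr; rewrite ger0_norm ?invr_ge0// invf_lt1// ltr1n.
have /choice[q Fq] : forall n, exists a, \forall v \near F, rnorm (v - a) < c n / 2.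
  by move=> n; apply: Fc; rewrite divr_gt0.
have qS n : rnorm (q n.+1 - q n) < c n.
  have [v [h1 h2]] := @filter_ex _ F _ _ (filterI (Fq n) (Fq n.+1)).
  move: h1 h2 => /= h1 h2; have := rnormD (q n.+1 - v) (v - q n).
  rewrite addrA subrK -(opprB v) rnormN; have := cS n; have := c0 n; lra.
pose y n := urepr (q n.+1 - q n).
pose d0 n i : V := if rnorm (y n i) < c n then y n i else 0.
have d0c n i : rnorm (d0 n i) <= c n.
  by rewrite /d0; case: ifPn => [/ltW//|_]; rewrite rnorm0 ltW.
have d0P n : d0 n \in @linfty_pred R k V I by apply/asboolP; exists (c n).
pose d n := Linfty (d0P n).
have dE n : uclass U (d n) = q n.+1 - q n.
  rewrite -[RHS]ureprK; apply: uclass_near_eq.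
  have : rnorm (uclass U (y n)) < c n by rewrite ureprK.
  by move/rnorm_uclass_lt; apply: filterS => i h; rewrite /d /d0 /= h.
pose s := fix s n := if n is m.+1 then s m + d m else urepr (q 0%N).
have sE n : uclass U (s n) = q n.
  elim: n => [|n IH] /=; first exact: ureprK.
  by rewrite uclassD IH dE addrC subrK.
have sS n i : s n.+1 i = s n i + d n i by [].
(* A geometric sum; the subtracted term lets the induction close and is dropped afterwards. *)
have sc i n m : rnorm (s (n + m)%N i - s n i) <= 2 * c n - 2 * c (n + m)%N.
  elim: m => [|m IH]; first by rewrite addn0 !subrr rnorm0.
  rewrite addnS sS addrAC.
  have := rnormD (s (n + m)%N i - s n i) (d (n + m)%N i).
  by have := d0c (n + m)%N i; have := cS (n + m)%N; rewrite -/(d0 _ _) /=; lra.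
have c2 : 2 * c n @[n --> \oo] --> (0 : R).
  by rewrite -(mulr0 2); apply: cvgMr.
have /choice[t ts] : forall i, exists l, forall n, rnorm (l - s n i) <= 2 * c n.
  move=> i; apply: cauchy_seq_cvg Vb c2 _ => n m.
  by have := sc i n m; have := c0 (n + m)%N; lra.
have tP : t \in @linfty_pred R k V I.
  have /asboolP[M hM] := linfty_funP (s 0%N).
  apply/asboolP; exists (M + 2 * c 0%N) => i.
  by have := rnorm_le_sub (t i) (s 0%N i); have := ts i 0%N; have := hM i; lra.
have tq n : rnorm (uclass U (Linfty tP) - q n) <= 2 * c n.
  by rewrite -sE -uclassB; apply: rnorm_uclass_le; apply: filterE => i; exact: ts.
apply/cvg_ex; exists (uclass U (Linfty tP)).
apply/(@cvg_rnormP _ _ _ _ _ FF id) => e e0.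
have e3 : 0 < e / 3 by lra.
move/cvgrPdist_lt: cc => /(_ _ e3)[N _ /(_ N (leqnn N))].
rewrite /= sub0r normrN gtr0_norm// => cN.
apply: filterS (Fq N) => v hv; have := rnormD (v - q N) (q N - uclass U (Linfty tP)).
rewrite addrA subrK -(opprB _ (q N)) rnormN; have := tq N; lra.
Qed.

End UltrapowerComplete.

(** * Closed subspaces as complete spaces, and a criterion for being isometric to a Hilbert space *)

Section Subspace.
Variables (R : realType) (k : scalar_kind).
Local Notation K := (scalar_field R k).
Variables (V : normedModType K) (S : set V) (hS : linear_subspace S).

Definition subspace_pred & linear_subspace S : pred V := fun x => `[< S x >].

Lemma subspace_submod_closed : submod_closed (subspace_pred hS).
Proof.
split; first by apply/asboolP; exact: hS.1.
by move=> a x y /asboolP Sx /asboolP Sy; apply/asboolP; exact: hS.2.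
Qed.

HB.instance Definition _ := GRing.isSubmodClosed.Build K V (subspace_pred hS)
  subspace_submod_closed.

Record subspace := Subspace {
  subspace_val :> V;
  subspace_valP : subspace_val \in subspace_pred hS }.

HB.instance Definition _ := [isSub for subspace_val].
HB.instance Definition _ := [Choice of subspace by <:].
HB.instance Definition _ := [SubChoice_isSubLmodule of subspace by <:].

Let subspace_normD (x y : subspace) : `|\val (x + y)| <= `|\val x| + `|\val y|.
Proof. exact: ler_normD. Qed.
Let subspace_normZ (a : K) (x : subspace) : `|\val (a *: x)| = `|a| * `|\val x|.
Proof. exact: normrZ. Qed.
Let subspace_norm0 (x : subspace) : `|\val x| = 0 -> x = 0.
Proof. by move=> /normr0_eq0 x0; apply: val_inj. Qed.

HB.instance Definition _ := Lmodule_isNormed.Build K subspace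
  subspace_normD subspace_normZ subspace_norm0.

Lemma closed_subspace_complete : banach_space V ->
  (forall x, (forall e : R, 0 < e -> exists2 s, S s & rnorm (x - s) < e) -> S x) ->
  banach_space subspace.
Proof.
move=> Vb Sc F FF /cauchy_rnormP Fc.
have : cauchy (subspace_val x @[x --> F]).
  by apply/cauchy_rnormP => e /Fc[a Fa]; exists (subspace_val a).
move=> VC; have /cvg_ex[l Fl] : cvg (subspace_val x @[x --> F]) by exact: Vb.
move/cvg_rnormP: Fl => Fl.
have Sl : S l.
  apply: Sc => e /Fl/filter_ex[x xl]; exists (subspace_val x).
    by have /asboolP := subspace_valP x.
  by rewrite -rnormN opprB.
have lP : l \in subspace_pred hS by exact/asboolP.
apply/cvg_ex; exists (Subspace lP).
by apply/(@cvg_rnormP _ _ _ _ _ FF id) => e /Fl.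
Qed.

(** The Hilbert space is S itself and the isometry is the inclusion: closedness supplies
    completeness, the parallelogram law supplies the form. *)
Lemma isometric_to_hilbert_subspace : banach_space V ->
  (forall x, (forall e : R, 0 < e -> exists2 s, S s & rnorm (x - s) < e) -> S x) ->
  (forall x y, S x -> S y ->
    rnorm (x + y) ^+ 2 + rnorm (x - y) ^+ 2 = 2 * (rnorm x ^+ 2 + rnorm y ^+ 2)) ->
  isometric_to_hilbert S.
Proof.
move=> Vb Sc P; have Wb := closed_subspace_complete Vb Sc.
pose G : completeNormedModType K :=
  HB.pack_for (completeNormedModType K) subspace (Uniform_isComplete.Build subspace Wb).
exists G; split.
  apply: hilbert_of_parallelogram => x y.
  have /asboolP Sx := subspace_valP x; have /asboolP Sy := subspace_valP y.
  exact: P.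
pose f : {linear G -> V} := HB.pack_for {linear G -> V} (subspace_val : G -> V)
  (GRing.isLinear.Build K G V *:%R subspace_val (fun a x y => erefl)).
exists f; split=> //; apply/seteqP; split=> [_ [x _ <-]|x Sx].
  by have /asboolP := subspace_valP x.
have xP : x \in subspace_pred hS by exact/asboolP.
by exists (Subspace xP).
Qed.

End Subspace.

(** * The Nakano direct sum *)

Section NakanoSpace.
Variables (R : realType) (k : scalar_kind) (p : exponents R).
Local Notation K := (scalar_field R k).
Variable E_ : nat -> normedModType K.
Local Notation E := (nakano_sum p E_).
Local Notation Theta := (modular_fun (nakano_modular p E_)).
Implicit Types x y z v : E.

Definition entry (n : nat) (x : E) : E_ n := nakano_seq (x : nakano_vect p E_) n.

Lemma entry_linear n a x y : entry n (a *: x + y) = a *: entry n x + entry n y.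
Proof. by []. Qed.

Lemma entryD n x y : entry n (x + y) = entry n x + entry n y.
Proof. by []. Qed.

Lemma entryB n x y : entry n (x - y) = entry n x - entry n y.
Proof. by []. Qed.

Lemma entryZ n a x : entry n (a *: x) = a *: entry n x.
Proof. by []. Qed.

Lemma entry0 n : entry n 0 = 0.
Proof. by []. Qed.

Lemma entry_ext x y : (forall n, entry n x = entry n y) -> x = y.
Proof.
move=> h; apply: val_inj; apply: functional_extensionality_dep => n; exact: h.
Qed.

Lemma rnorm_nakano x : rnorm x = luxemburg (nakano_modular p E_) x.
Proof. by rewrite /rnorm of_realK. Qed.

Lemma exponent_gt0 n : 0 < p n.
Proof. exact: lt_le_trans ltr01 (exponent_ge1 p n). Qed.

Lemma exponent_powR_le n (s t : R) : 0 <= s -> s <= t -> s `^ p n <= t `^ p n.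
Proof.
move=> s0 st; have := @ge0_ler_powR R (p n) (ltW (exponent_gt0 n)) s t.
by rewrite !nnegrE; apply => //; exact: le_trans st.
Qed.

(** Defined for arbitrary families, because a bound on these sums is the test by which a family is
    recognized as an element of E. *)
Definition psum (N : nat) (s : prod_space E_) : R := \sum_(n < N) rnorm (s n) `^ p n.

Definition entries x : prod_space E_ := fun n => entry n x.

Lemma entriesE x n : entries x n = entry n x.
Proof. by []. Qed.

Lemma theta_series x :
  (Theta x)%:E = (\sum_(n <oo) (rnorm (entry n x) `^ p n)%:E)%E.
Proof.
have e : nakano_series p (fun n => `|entry n x|) =
    (\sum_(n <oo) (rnorm (entry n x) `^ p n)%:E)%E.
  by apply: eq_eseriesr => n _; rewrite normr_id.
rewrite /= /nakano_theta [in LHS]e fineK// ge0_fin_numE.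
  by rewrite -e; have /asboolP := nakano_seqP x.
by apply: nneseries_ge0 => n _ _; rewrite lee_fin powR_ge0.
Qed.

Lemma psum_le_theta N x : psum N (entries x) <= Theta x.
Proof.
rewrite -lee_fin theta_series /psum -sumEFin.
rewrite -(big_mkord xpredT (fun n => (rnorm (entry n x) `^ p n)%:E)).
by apply: nneseries_lim_ge => n _; rewrite lee_fin powR_ge0.
Qed.

Lemma theta_le x (C : R) : (forall N, psum N (entries x) <= C) -> Theta x <= C.
Proof.
move=> h; rewrite -lee_fin theta_series; apply: lime_le.
  by apply: is_cvg_nneseries => n _ _; rewrite lee_fin powR_ge0.
apply: nearW => N; rewrite sumEFin big_mkord lee_fin; exact: h.
Qed.

Lemma psum_bounded_vector (s : prod_space E_) (C : R) : (forall N, psum N s <= C) ->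
  exists x, forall n, entry n x = s n.
Proof.
move=> h; suff sP : s \in nakano_pred p (E_:=E_) by exists (NakanoVect sP).
apply/asboolP; rewrite /nakano/= /nakano_series.
apply: (@le_lt_trans _ _ C%:E); last exact: ltry.
apply: lime_le.
  by apply: is_cvg_nneseries => n _ _; rewrite lee_fin powR_ge0.
apply: nearW => N; rewrite sumEFin big_mkord lee_fin; apply: le_trans (h N).
by apply: ler_sum => n _; rewrite normr_id.
Qed.

Lemma psum_nondecreasing (s : prod_space E_) (M N : nat) : (N <= M)%N -> psum N s <= psum M s.
Proof.
move=> NM; rewrite /psum (big_ord_widen _ (fun n => rnorm (s n) `^ p n) NM).
rewrite [leRHS](bigID (fun i : 'I_M => (i < N)%N))/= lerDl.
by apply: sumr_ge0 => i _; exact: powR_ge0.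
Qed.

Lemma psum_cvg x : psum N (entries x) @[N --> \oo] --> Theta x.
Proof.
apply/cvgrPdist_lt => e e0.
have [N hN] : exists N, Theta x - e < psum N (entries x).
  apply: contrapT => h; have : Theta x <= Theta x - e; last by lra.
  by apply: theta_le => N; rewrite leNgt; apply/negP => hN; apply: h; exists N.
exists N => // M NM; have := psum_le_theta M x.
by rewrite -subr_ge0 => h; rewrite ger0_norm//; have := psum_nondecreasing (entries x) NM; lra.
Qed.

Lemma theta_le_comb (c d : R) x y z : 0 <= c -> 0 <= d ->
  (forall n, rnorm (entry n z) `^ p n <=
     c * rnorm (entry n x) `^ p n + d * rnorm (entry n y) `^ p n) ->
  Theta z <= c * Theta x + d * Theta y.
Proof.
move=> c0 d0 h; apply: theta_le => N.
apply: (@le_trans _ _ (c * psum N (entries x) + d * psum N (entries y))).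
  by rewrite /psum !mulr_sumr -big_split/=; apply: ler_sum => n _; exact: h.
by rewrite lerD// ler_wpM2l// psum_le_theta.
Qed.

Lemma theta_le_scale (c : R) x z : 0 <= c ->
  (forall n, rnorm (entry n z) `^ p n <= c * rnorm (entry n x) `^ p n) ->
  Theta z <= c * Theta x.
Proof.
move=> c0 h; have := @theta_le_comb c 0 x x z c0 (lexx 0).
by rewrite mul0r addr0; apply => n; rewrite mul0r addr0.
Qed.

Lemma theta_ge0 x : 0 <= Theta x.
Proof. exact: modular_ge0. Qed.

Lemma theta_disjointD x y : (forall n, entry n x = 0 \/ entry n y = 0) ->
  Theta (x + y) = Theta x + Theta y.
Proof.
move=> h; have e N : psum N (entries (x + y)) = psum N (entries x) + psum N (entries y).
  rewrite /psum -big_split; apply: eq_bigr => n _; rewrite !entriesE entryD.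
  have z : (0 : R) `^ p n = 0 by rewrite powR0// gt_eqF// exponent_gt0.
  by case: (h n) => ->; rewrite rnorm0 z [RHS]/= ?add0r ?addr0.
have h2 : psum N (entries (x + y)) @[N --> \oo] --> Theta x + Theta y.
  by rewrite (funext e); apply: cvgD; exact: psum_cvg.
exact: (cvg_unique _ (@psum_cvg (x + y)) h2).
Qed.

Lemma exponent_max : exists2 P : R, 1 <= P & forall n, p n <= P.
Proof.
have [M hM] := exponent_bounded p; exists M => //.
exact: le_trans (exponent_ge1 p 0) (hM 0%N).
Qed.

Lemma rnorm_le_theta x (r : R) : 0 < r -> Theta (of_real r^-1 *: x) <= 1 -> rnorm x <= r.
Proof.
move=> r0; rewrite rnorm_nakano -of_realV => h.
by apply: lux_le; split; [exact: r0|exact: h].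
Qed.

Lemma rnorm_lt_theta x (r : R) : rnorm x < r -> Theta (of_real r^-1 *: x) <= 1.
Proof. by rewrite rnorm_nakano -of_realV => /lux_ltP[_]; apply. Qed.

Lemma rnorm_scaled (W : normedModType K) (t : R) (w : W) : 0 <= t ->
  rnorm (of_real t *: w) = t * rnorm w.
Proof. by move=> t0; rewrite rnormZ re_norm_of_real. Qed.

Lemma theta_scale_ge1 (t P : R) x : (forall n, p n <= P) -> 1 <= t ->
  Theta (of_real t *: x) <= t `^ P * Theta x.
Proof.
move=> pP t1; have t0 : 0 <= t by lra.
apply: theta_le_scale => [|n]; first exact: powR_ge0.
rewrite entryZ rnorm_scaled// powRM ?rnorm_ge0//.
by rewrite ler_wpM2r ?powR_ge0// ler_powR.
Qed.

Lemma theta_le_rnorm (P r : R) x : (forall n, p n <= P) -> 1 <= r -> rnorm x < r ->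
  Theta x <= r `^ P.
Proof.
move=> pP r1 /rnorm_lt_theta h; have r0 : 0 < r by lra.
have := theta_scale_ge1 (of_real r^-1 *: x) pP r1.
rewrite scalerA -rmorphM divff ?gt_eqF// rmorph1 scale1r => /le_trans; apply.
by rewrite ler_piMr// powR_ge0.
Qed.

(** Boundedness of the exponents makes modular smallness imply norm smallness: enlarging x by the
    factor 1/e >= 1 multiplies the modular by at most e^(-P). *)
Lemma theta_small (P e : R) x : (forall n, p n <= P) -> 0 < e <= 1 -> Theta x <= e `^ P ->
  rnorm x <= e.
Proof.
move=> pP /andP[e0 e1] h; apply: rnorm_le_theta => //.
have ei : 1 <= e^-1 by rewrite invf_ge1.
apply: le_trans (theta_scale_ge1 _ pP ei) _.
have eP : 0 < e `^ P by rewrite powR_gt0.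
have -> : (e^-1) `^ P = (e `^ P)^-1.
  by rewrite -powR_inv1 ?ltW// -powRrM mulN1r powRN.
by rewrite ler_pdivrMl// mulr1.
Qed.

Lemma theta_mono x y : (forall n, rnorm (entry n x) <= rnorm (entry n y)) ->
  Theta x <= Theta y.
Proof.
move=> h; have := @theta_le_scale 1 y x ler01; rewrite mul1r; apply => n.
by rewrite mul1r exponent_powR_le ?rnorm_ge0.
Qed.

Lemma rnorm_mono x y : (forall n, rnorm (entry n x) <= rnorm (entry n y)) ->
  rnorm x <= rnorm y.
Proof.
move=> h; apply/ler_addgt0Pr => e e0.
have r0 : 0 < rnorm y + e by have := rnorm_ge0 y; lra.
apply: rnorm_le_theta => //; apply: (@le_trans _ _ (Theta (of_real (rnorm y + e)^-1 *: y))).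
  have ri : 0 <= (rnorm y + e)^-1 by rewrite invr_ge0 ltW.
  by apply: theta_mono => n; rewrite !entryZ !rnorm_scaled// ler_wpM2l.
by apply: rnorm_lt_theta; rewrite ltrDl.
Qed.

Lemma rnorm_entry_le n x : rnorm (entry n x) <= rnorm x.
Proof.
apply/ler_addgt0Pr => e e0; set r := rnorm x + e.
have r0 : 0 < r by rewrite /r; have := rnorm_ge0 x; lra.
have /rnorm_lt_theta h : rnorm x < r by rewrite /r ltrDl.
have := le_trans (psum_le_theta n.+1 _) h.
have ri : 0 <= r^-1 by rewrite invr_ge0 ltW.
rewrite /psum big_ord_recr entriesE entryZ rnorm_scaled// => h1.
have h2 : (r^-1 * rnorm (entry n x)) `^ p n <= 1.
  apply: le_trans h1; rewrite lerDr; apply: sumr_ge0 => i _; exact: powR_ge0.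
have h3 : r^-1 * rnorm (entry n x) <= 1.
  rewrite leNgt; apply/negP => h3.
  have := @gt0_ltr_powR R (p n) (exponent_gt0 n) 1 (r^-1 * rnorm (entry n x)).
  rewrite !nnegrE powR1 ler01 (le_trans ler01 (ltW h3)) => /(_ isT isT h3).
  by rewrite ltNge h2.
by move: h3; rewrite ler_pdivrMl// mulr1.
Qed.

Lemma entry_dual n (g : cont_dual (E_ n)) :
  exists G : cont_dual E, forall x, G x = g (entry n x).
Proof.
apply: (@cont_dual_exists R k E (fun x => g (entry n x)) (rnorm g)) => [a x y|x].
  exact: dual_linear.
by apply: le_trans (dual_le _ _) _; rewrite ler_wpM2l ?rnorm_ge0// rnorm_entry_le.
Qed.

Lemma trunc_subproof N x : exists y, forall n, entry n y = if (n < N)%N then entry n x else 0.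
Proof.
apply: (@psum_bounded_vector (fun n => if (n < N)%N then entry n x else 0) (Theta x)) => M.
apply: le_trans (psum_le_theta M x); apply: ler_sum => n _.
by case: ifP => // _; rewrite rnorm0 exponent_powR_le ?rnorm_ge0.
Qed.

Definition trunc N x : E := sval (cid (trunc_subproof N x)).

Lemma entry_trunc N x n : entry n (trunc N x) = if (n < N)%N then entry n x else 0.
Proof. exact: (svalP (cid (trunc_subproof N x))). Qed.

Definition tail N x : E := x - trunc N x.

Lemma entry_tail N x n : entry n (tail N x) = if (n < N)%N then 0 else entry n x.
Proof. by rewrite entryB entry_trunc; case: ifP; rewrite ?subrr ?subr0. Qed.

Lemma trunc_tail N x : x = trunc N x + tail N x.
Proof. by rewrite addrC subrK. Qed.

Lemma trunc_linear N a x y : trunc N (a *: x + y) = a *: trunc N x + trunc N y.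
Proof.
apply: entry_ext => n; rewrite entry_linear !entry_trunc entry_linear.
by case: ifP => // _; rewrite scaler0 addr0.
Qed.

Lemma truncZ N a x : trunc N (a *: x) = a *: trunc N x.
Proof. by apply: entry_ext => n; rewrite entryZ !entry_trunc; case: ifP; rewrite ?scaler0. Qed.

Lemma tailZ N a x : tail N (a *: x) = a *: tail N x.
Proof. by rewrite /tail truncZ scalerBr. Qed.

Lemma rnorm_trunc_le N x : rnorm (trunc N x) <= rnorm x.
Proof.
by apply: rnorm_mono => n; rewrite entry_trunc; case: ifP => // _; rewrite rnorm0 rnorm_ge0.
Qed.

Lemma rnorm_tail_le N x : rnorm (tail N x) <= rnorm x.
Proof.
by apply: rnorm_mono => n; rewrite entry_tail; case: ifP => // _; rewrite rnorm0 rnorm_ge0.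
Qed.

Lemma theta_tail_le N x : Theta (tail N x) <= Theta x.
Proof.
by apply: theta_mono => n; rewrite entry_tail; case: ifP => // _; rewrite rnorm0 rnorm_ge0.
Qed.

Lemma theta_trunc_le N x : Theta (trunc N x) <= Theta x.
Proof.
by apply: theta_mono => n; rewrite entry_trunc; case: ifP => // _; rewrite rnorm0 rnorm_ge0.
Qed.

Lemma theta_trunc_tail N x y : Theta (trunc N x + tail N y) = Theta (trunc N x) + Theta (tail N y).
Proof.
apply: theta_disjointD => n; rewrite entry_trunc entry_tail.
by case: ifP => _; [right|left].
Qed.

Lemma theta_trunc N x : Theta (trunc N x) = psum N (entries x).
Proof.
apply/eqP; rewrite eq_le; apply/andP; split; last first.
  apply: le_trans (psum_le_theta N _); apply: ler_sum => n _.
  by rewrite !entriesE entry_trunc ltn_ord.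
apply: theta_le => M; apply: (@le_trans _ _ (psum (maxn M N) (entries (trunc N x)))).
  by apply: psum_nondecreasing; rewrite leq_maxl.
rewrite /psum (big_ord_widen (maxn M N) (fun n => rnorm (entries x n) `^ p n)) ?leq_maxr//.
rewrite [leRHS]big_mkcond/=; apply: ler_sum => n _; rewrite !entriesE entry_trunc.
by case: ifP => // _; rewrite rnorm0 powR0// gt_eqF// exponent_gt0.
Qed.

Lemma theta_tail_cvg x : Theta (tail N x) @[N --> \oo] --> (0 : R).
Proof.
have e N : Theta (tail N x) = Theta x - psum N (entries x).
  by rewrite -theta_trunc [in X in X - _](trunc_tail N x) theta_trunc_tail addrC addKr.
by rewrite (funext e) -(subrr (Theta x)); apply: cvgB; [exact: cvg_cst|exact: psum_cvg].
Qed.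

Lemma rnorm_tail_cvg x (e : R) : 0 < e -> \forall N \near \oo, rnorm (tail N x) < e.
Proof.
move=> e0; have [P P1 pP] := exponent_max.
pose d := Num.min (e / 2) 1.
have d0 : 0 < d by rewrite lt_min ltr01 divr_gt0.
have d1 : d <= 1 by rewrite ge_min lexx orbT.
have de : d <= e / 2 by rewrite ge_min lexx.
have /cvgrPdist_lt := @theta_tail_cvg x => /(_ _ (powR_gt0 P d0)).
apply: filterS => N; rewrite sub0r normrN ger0_norm ?theta_ge0// => /ltW h.
have := theta_small pP _ h; rewrite d0 d1 => /(_ isT); lra.
Qed.

End NakanoSpace.

(** * Reflexivity of the Nakano direct sum *)

Section NakanoDual.
Variables (R : realType) (k : scalar_kind) (p : exponents R).
Local Notation K := (scalar_field R k).
Variable E_ : nat -> normedModType K.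
Hypothesis p_cvg : p n @[n --> \oo] --> (2 : R).
Local Notation E := (nakano_sum p E_).
Local Notation Theta := (modular_fun (nakano_modular p E_)).
Implicit Types (x y z v : E) (f : cont_dual E).

Lemma exponents_eventually (e : R) : 0 < e ->
  exists N, forall n, (N <= n)%N -> `|2 - p n| < e.
Proof. by move=> e0; move/cvgrPdist_lt: p_cvg => /(_ _ e0)[N _ hN]; exists N. Qed.

Lemma re_linear_real (t : R) (z : K) : 0 <= t -> re (of_real t * z) = t * re z.
Proof.
by case: k z => [z|[a b]] t0 //=; rewrite mul0r subr0.
Qed.

(* m disjointly supported vectors of modular at most 1 have a sum of modular at
   most m, which beyond N0 has norm at most m^(2/3) since p n >= 3/2 there. *)
Lemma block_sums f (e : R) :
  (forall N, exists v, [/\ forall n, (n < N)%N -> entry n v = 0, Theta v <= 1 & e < re (f v)]) ->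
  forall m N, exists v, [/\ forall n, (n < N)%N -> entry n v = 0, Theta v <= m%:R
    & m%:R * e <= re (f v)].
Proof.
move=> h; elim=> [|m IH] N.
  exists 0; split; first by move=> n _; exact: entry0.
    by rewrite modular0.
  by rewrite dual0 mul0r (raddf0 (@re R k)) lexx.
have [u [uN u1 fu]] := h N.
(* Cutting u to a finite support lets the remaining vectors start beyond M. The tail is taken so
   small that its value under f stays below the gap re (f u) - e. *)
have [M hM] : exists M, e < re (f (trunc M u)).
  have C0 : 0 < rnorm f + 1 by have := rnorm_ge0 f; lra.
  have d0 : 0 < (re (f u) - e) / (rnorm f + 1) by rewrite divr_gt0// subr_gt0.
  have [M _ /(_ M (leqnn M)) hM] := rnorm_tail_cvg u d0; exists M.
  have ht : re (f (tail M u)) <= rnorm f * rnorm (tail M u).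
    by apply: le_trans (re_le_norm _) (dual_le _ _).
  have hE : re (f u) = re (f (trunc M u)) + re (f (tail M u)).
    by rewrite -(raddfD (@re R k)) -dualD -trunc_tail.
  have := rnorm_ge0 (tail M u); have := rnorm_ge0 f.
  by move: hM; rewrite ltr_pdivlMr//; nra.
have [v [vM vm fv]] := IH (maxn M N).
exists (trunc M u + v); split.
- move=> n nN; rewrite entryD entry_trunc (uN n nN) vM ?leq_max ?nN ?orbT//.
  by case: ifP; rewrite addr0.
- rewrite theta_disjointD; last first.
    move=> n; rewrite entry_trunc; case: ltnP => nM; [right|by left].
    by apply: vM; rewrite leq_max nM.
  rewrite -natr1 addrC; apply: lerD; first exact: vm.
  exact: le_trans (theta_trunc_le _ _) u1.
- by rewrite dualD (raddfD (@re R k)) -natr1 mulrDl mul1r addrC lerD// ltW.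
Qed.

Lemma theta_scale_tail N (s : R) v : (forall n, (N <= n)%N -> `|2 - p n| < 2^-1) ->
  (forall n, (n < N)%N -> entry n v = 0) -> 0 < s <= 1 ->
  Theta (of_real s *: v) <= s `^ (3 / 2) * Theta v.
Proof.
move=> pN vN s01; have /andP[s0 s1] := s01.
apply: theta_le_scale => [|n]; first exact: powR_ge0.
rewrite entryZ rnorm_scaled ?(ltW s0)// powRM ?rnorm_ge0 ?(ltW s0)//.
have [nN|nN] := ltnP n N.
  have z : (0 : R) `^ p n = 0 by rewrite powR0// gt_eqF// exponent_gt0.
  by rewrite vN// rnorm0 z !mulr0.
rewrite ler_wpM2r ?powR_ge0// ger_powR//.
by have := pN n nN; rewrite ltr_norml => /andP[h1 h2]; lra.
Qed.

Lemma dual_tail_small_re f (e : R) : 0 < e -> exists N, forall v,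
  (forall n, (n < N)%N -> entry n v = 0) -> Theta v <= 1 -> re (f v) <= e.
Proof.
move=> e0; apply: contrapT => h.
have /block_sums B : forall N, exists v,
    [/\ forall n, (n < N)%N -> entry n v = 0, Theta v <= 1 & e < re (f v)].
  move=> N; apply: contrapT => hN; apply: h; exists N => v vN v1.
  by rewrite leNgt; apply/negP => ev; apply: hN; exists v.
have [|N0 pN0] := @exponents_eventually 2^-1; first by rewrite invr_gt0.
(* With j^3 vectors and the scaling factor s = j^(-2), s^(3/2) is exactly j^(-3). The scaled sum
   thus has modular at most 1, hence lies in the unit ball, while f has real part at least j^(-2)
   j^3 e = j e on it. *)
have be (j : nat) : (0 < j)%N -> j%:R * e <= rnorm f.
  move=> j0; have jR : (0 : R) < j%:R by rewrite ltr0n.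
  have [v [vN vm fv]] := B (j ^ 3)%N N0.
  pose s : R := j%:R ^- 2.
  have s0 : 0 < s by rewrite invr_gt0 exprn_gt0.
  have s1 : s <= 1 by rewrite invf_le1 ?exprn_gt0// exprn_ege1// ler1n.
  have ss : s `^ (3 / 2) = j%:R ^- 3.
    rewrite /s -powR_invn ?(ltW jR)// -powRrM.
    rewrite (_ : - 2%:R * (3 / 2) = - 3%:R); last by field.
    by rewrite powR_invn// ltW.
  have s01 : 0 < s <= 1 by rewrite s0.
  have sv : Theta (of_real s *: v) <= 1.
    apply: le_trans (theta_scale_tail pN0 vN s01) _; rewrite ss.
    by rewrite ler_pdivrMl ?exprn_gt0// mulr1 -natrX.
  have nv : rnorm (of_real s *: v) <= 1.
    by apply: (rnorm_le_theta ltr01); rewrite invr1 rmorph1 scale1r; exact: sv.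
  have : re (f (of_real s *: v)) <= rnorm f.
    apply: le_trans (re_le_norm _) _; apply: le_trans (dual_le _ _) _.
    by rewrite ler_piMr ?rnorm_ge0.
  rewrite dualZ [_ *: _]/(_ * _) re_linear_real ?(ltW s0)//; apply: le_trans.
  apply: le_trans (_ : s * ((j ^ 3)%:R * e) <= _); last by rewrite ler_wpM2l// ltW.
  rewrite mulrA natrX /s le_eqVlt; apply/orP; left; apply/eqP.
  by field; rewrite gt_eqF.
have fe : 0 <= rnorm f / e by rewrite divr_ge0 ?rnorm_ge0// ltW.
have := Num.Theory.archi_boundP fe; set j := Num.bound _.
rewrite ltr_pdivrMr// => hj; have j0 : (0 < j)%N.
  by rewrite lt0n; apply: contraTneq hj => ->; rewrite mul0r -leNgt rnorm_ge0.
by have := be j j0; rewrite leNgt hj.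
Qed.

(** The bound on the real part is homogenized: x is divided by some r above its norm, which brings
    its modular below 1, and its tail is rotated until f takes a nonnegative real value; the modular
    is invariant under the rotation. *)
Lemma dual_tail_small f (e : R) : 0 < e -> exists N, forall x,
  rnorm (f (tail N x)) <= e * rnorm x.
Proof.
move=> e0; have [N hN] := dual_tail_small_re f e0; exists N => x.
rewrite mulrC -ler_pdivrMr//; apply/ler_addgt0Pr => d d0.
rewrite ler_pdivrMr//; set r := rnorm x + d.
have r0 : 0 < r by rewrite /r; have := rnorm_ge0 x; lra.
have /rnorm_lt_theta h : rnorm x < r by rewrite /r ltrDl.
have [->|f0] := eqVneq (f (tail N x)) 0; first by rewrite rnorm0 mulr_ge0// ltW.
pose w : K := f (tail N x).
have w0 : w != 0 by exact: f0.
pose u : K := `|w| / w.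
have u1 : `|u| = 1 by rewrite normf_div normr_id divff// normr_eq0.
have := hN (u *: tail N (of_real r^-1 *: x)).
have vN n : (n < N)%N -> entry n (u *: tail N (of_real r^-1 *: x)) = 0.
  by move=> nN; rewrite entryZ entry_tail nN scaler0.
have v1 : Theta (u *: tail N (of_real r^-1 *: x)) <= 1.
  rewrite modular_circled; last exact: u1.
  exact: le_trans (theta_tail_le _ _) h.
move=> /(_ vN v1); rewrite tailZ scalerA mulrC -scalerA !dualZ.
rewrite [X in re X](_ : _ = of_real r^-1 * (u * w))// re_linear_real ?invr_ge0 ?(ltW r0)//.
by rewrite /u divfK// ler_pdivrMl.
Qed.

End NakanoDual.

Section NakanoReflexive.
Variables (R : realType) (k : scalar_kind) (p : exponents R).
Local Notation K := (scalar_field R k).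
Variable E_ : nat -> normedModType K.
Hypothesis p_cvg : p n @[n --> \oo] --> (2 : R).
Hypothesis E_findim : forall n, finite_dimensional (E_ n).
Local Notation E := (nakano_sum p E_).
Local Notation Theta := (modular_fun (nakano_modular p E_)).
Implicit Types (x y z v : E) (f : cont_dual E).

(** The blocks have different types, so a has to be transported along a proof of n = m. *)
Definition single_fun (n : nat) (a : E_ n) : prod_space E_ := fun m =>
  match @eqP _ n m with ReflectT e => eq_rect n (fun i => E_ i : Type) a m e | _ => 0 end.

Lemma single_fun_same n (a : E_ n) : single_fun a n = a.
Proof. by rewrite /single_fun; case: eqP => // e; rewrite eq_axiomK. Qed.

Lemma single_fun_other n m (a : E_ n) : n != m -> single_fun a m = 0.
Proof. by rewrite /single_fun; case: eqP => // e /eqP. Qed.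

Lemma single_subproof n (a : E_ n) : exists x, forall m, entry m x = single_fun a m.
Proof.
apply: (@psum_bounded_vector _ _ _ _ (single_fun a) (rnorm a `^ p n)) => N.
have z : (0 : R) `^ p n = 0 by rewrite powR0// gt_eqF// exponent_gt0.
have [nN|Nn] := ltnP n N.
  rewrite /psum (bigD1 (Ordinal nN))//= single_fun_same big1 ?addr0// => m mn.
  rewrite single_fun_other; last by apply: contraNneq mn => nm; apply/eqP/val_inj.
  by rewrite rnorm0 powR0// gt_eqF// exponent_gt0.
rewrite /psum big1 ?powR_ge0// => m _; rewrite single_fun_other.
  by rewrite rnorm0 powR0// gt_eqF// exponent_gt0.
by rewrite gtn_eqF// (leq_trans (ltn_ord m)).
Qed.

Definition single n (a : E_ n) : E := sval (cid (single_subproof a)).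

Lemma entry_single n (a : E_ n) m : entry m (single a) = single_fun a m.
Proof. exact: (svalP (cid (single_subproof a))). Qed.

Lemma single_linear n (c : K) (a b : E_ n) : single (c *: a + b) = c *: single a + single b.
Proof.
apply: entry_ext => m; rewrite entry_linear !entry_single.
have [<-|nm] := eqVneq n m; first by rewrite !single_fun_same.
by rewrite !single_fun_other// scaler0 addr0.
Qed.

Lemma single0 n : single (0 : E_ n) = 0.
Proof.
apply: entry_ext => m; rewrite entry_single.
have [<-|nm] := eqVneq n m; first by rewrite single_fun_same.
by rewrite single_fun_other.
Qed.

Lemma single_sum n (I : Type) (r : seq I) (c : I -> K) (b : I -> E_ n) :
  single (\sum_(i <- r) c i *: b i) = \sum_(i <- r) c i *: single (b i).
Proof.
elim: r => [|i r IH]; first by rewrite !big_nil single0.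
by rewrite !big_cons single_linear IH.
Qed.

Lemma entry_sum n (I : Type) (r : seq I) (F : I -> E) :
  entry n (\sum_(i <- r) F i) = \sum_(i <- r) entry n (F i).
Proof.
elim: r => [|i r IH]; first by rewrite !big_nil entry0.
by rewrite !big_cons entryD IH.
Qed.

Lemma entry_sum_single (s : prod_space E_) N m :
  entry m (\sum_(n <- iota 0 N) single (s n)) = if (m < N)%N then s m else 0.
Proof.
rewrite entry_sum; case: ltnP => mN.
  rewrite (bigD1_seq m) ?iota_uniq ?mem_iota//= entry_single single_fun_same big1 ?addr0//.
  by move=> n nm; rewrite entry_single single_fun_other.
rewrite big_seq big1// => n; rewrite mem_iota/= add0n => nN.
by rewrite entry_single single_fun_other// ltn_eqF// (leq_trans nN).
Qed.

Lemma trunc_sum_single N x : trunc N x = \sum_(n <- iota 0 N) single (entry n x).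
Proof. by apply: entry_ext => m; rewrite entry_trunc (@entry_sum_single (entries x)). Qed.

Lemma entry_system n : exists l : seq (E_ n * cont_dual E),
  forall x, entry n x = \sum_(e <- l) (e.2 x : K) *: e.1.
Proof.
have [l hl] := finite_dual_basis (E_findim n).
have [G hG] := choice (@entry_dual R k p E_ n).
exists [seq (e.1, G e.2) | e <- l] => x; rewrite [LHS]hl big_map.
by apply: eq_bigr => e _; rewrite hG.
Qed.

(** Truncations have finite rank with continuous coordinates. This is the form in which the finite
    dimension of the blocks is used, both for reflexivity and for the norm convergence of initial
    segments of weakly null families. *)
Lemma trunc_system N : exists l : seq (E * cont_dual E),
  forall x, trunc N x = \sum_(e <- l) (e.2 x : K) *: e.1.
Proof.
elim: N => [|N [l hl]].
  exists [::] => x; rewrite big_nil; apply: entry_ext => n.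
  by rewrite entry_trunc ltn0 entry0.
have [m hm] := entry_system N.
exists ([seq (single e.1, e.2) | e <- m] ++ l) => x.
rewrite big_cat big_map -hl [LHS]trunc_sum_single -addn1 iotaD big_cat/= big_seq1.
by rewrite -trunc_sum_single hm single_sum addrC.
Qed.

Lemma dual_trunc_exists f N : exists g : cont_dual E, forall x, g x = f (trunc N x).
Proof.
apply: (@cont_dual_exists R k E (fun x => f (trunc N x)) (rnorm f)) => [a x y|x].
  by rewrite trunc_linear dual_linear.
exact: le_trans (dual_le f (trunc N x)) (ler_wpM2l (rnorm_ge0 f) (rnorm_trunc_le N x)).
Qed.

Lemma dual_ext (f g : cont_dual E) : (forall x, f x = g x) -> f = g.
Proof. by move=> h; apply: val_inj; apply/funext. Qed.

Lemma trunc_trunc N M x : (N <= M)%N -> trunc N (trunc M x) = trunc N x.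
Proof.
move=> NM; apply: entry_ext => n; rewrite !entry_trunc.
by case: ltnP => // nN; rewrite (leq_trans nN NM).
Qed.

(** Writing the truncation as a sum of e.2 x times e.1 turns f composed with it into the sum of f
    e.1 times e.2. Applying phi and exchanging the factors gives f at the sum of phi e.2 times
    e.1. *)
Lemma bidual_trunc (phi : cont_dual (cont_dual E)) N : exists X : E,
  forall f (g : cont_dual E), (forall x, g x = f (trunc N x)) -> phi g = f X.
Proof.
have [l hl] := trunc_system N.
exists (\sum_(e <- l) (phi e.2 : K) *: e.1) => f g hg.
have -> : g = \sum_(e <- l) (f e.1 : K) *: e.2.
  apply: dual_ext => x; rewrite hg hl dual_sum.
  have -> : (\sum_(e <- l) (f e.1 : K) *: e.2) x = \sum_(e <- l) (f e.1 : K) *: (e.2 x).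
    by elim: l {hl} => [|e l IH]; rewrite ?big_nil// !big_cons -IH.
  by apply: eq_bigr => e _; rewrite dualZ [LHS]mulrC.
rewrite !dual_sum; apply: eq_bigr => e _.
by rewrite !dualZ [LHS]mulrC.
Qed.

(** The vectors X N that represent phi on functionals composed with [trunc N] are compatible and
    bounded by the norm of phi, so their entries form one vector x of E. Since f is approximated in
    the dual norm by its compositions with truncations, phi f = f x. *)
Lemma nakano_reflexive : reflexive_space E.
Proof.
move=> phi; have [X hX] := choice (bidual_trunc phi).
have XX N M : (N <= M)%N -> trunc N (X M) = X N.
  move=> NM; apply: dual_separates => f.
  have [g hg] := dual_trunc_exists f N.
  rewrite -hg -(hX N f g hg); apply/esym/hX => x.
  by rewrite !hg trunc_trunc.
have Xb N : rnorm (X N) <= rnorm phi.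
  have [f [f1 <-]] := norming_functional (X N).
  have [g hg] := dual_trunc_exists f N.
  rewrite -(hX N f g hg); apply: le_trans (re_le_norm _) _.
  apply: le_trans (dual_le phi g) _; rewrite ler_piMr ?rnorm_ge0//.
  apply: dual_le_bound => // x; rewrite hg mul1r.
  by apply: le_trans (f1 _) _; exact: rnorm_trunc_le.
have [P P1 pP] := exponent_max p.
(* The index n + 1 is the least N for which a truncation at N retains entry n. *)
pose s : prod_space E_ := fun n => entry n (X n.+1).
have Xs N n : entry n (X N) = if (n < N)%N then s n else 0.
  rewrite -(XX N N (leqnn N)) entry_trunc; case: ifP => // nN.
  by rewrite /s -(XX n.+1 N nN) entry_trunc leqnn.
have [x hx] : exists x, forall n, entry n x = s n.
  apply: (@psum_bounded_vector _ _ _ _ s ((rnorm phi + 1) `^ P)) => N.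
  apply: (@le_trans _ _ (Theta (X N))).
    apply: le_trans (psum_le_theta N _); apply: ler_sum => n _.
    by rewrite entriesE Xs ltn_ord.
  apply: theta_le_rnorm => //; first by have := rnorm_ge0 phi; lra.
  by apply: le_lt_trans (Xb N) _; rewrite ltrDl.
have xX N : trunc N x = X N.
  by apply: entry_ext => n; rewrite entry_trunc Xs hx.
exists x => f; apply/eqP; rewrite -subr_eq0; apply/eqP/rnorm0_eq0.
apply/eqP; rewrite eq_le rnorm_ge0 andbT; apply/ler_addgt0Pr => e e0; rewrite add0r.
(* Room for two errors, phi (f - g) and f at the tail of x, which are at most e/c times the norms of
   phi and of x; the 1 keeps c positive. *)
pose c := rnorm phi + rnorm x + 1.
have c0 : 0 < c by rewrite /c; have := rnorm_ge0 phi; have := rnorm_ge0 x; lra.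
have [N hN] := dual_tail_small p_cvg f (divr_gt0 e0 c0).
have [g hg] := dual_trunc_exists f N.
have fg : rnorm (f - g) <= e / c.
  apply: dual_le_bound => [|v]; first by rewrite divr_ge0 ?ltW.
  have -> : (f - g) v = f (tail N v) by rewrite /tail dualB -hg.
  exact: hN.
have -> : phi f - f x = phi (f - g) - f (tail N x).
  by rewrite dualB (hX N f g hg) -xX /tail dualB opprB addrA subrK.
apply: le_trans (rnormD _ _) _; rewrite rnormN.
have h1 := dual_le phi (f - g); have h2 := hN x.
have h3 : rnorm phi * rnorm (f - g) <= rnorm phi * (e / c) by rewrite ler_wpM2l ?rnorm_ge0.
have h4 : e = e / c * rnorm phi + e / c * rnorm x + e / c by rewrite /c; field; rewrite gt_eqF.
have h5 : 0 < e / c by rewrite divr_gt0.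
rewrite [leRHS]h4; lra.
Qed.

End NakanoReflexive.

(** * The weak limit projection *)

Section ReflexiveUltrapower.
Variables (R : realType) (k : scalar_kind).
Local Notation K := (scalar_field R k).
Variables (V : normedModType K) (I : Type) (U : ultrafilter I).
Hypothesis Vr : reflexive_space V.
Implicit Types q r : ultrapower V U.
Local Notation P := (@weak_limit_proj R k V I U).

(** A weak limit of one representative is one of every other, since a functional maps a difference
    that is null along U to a null family. Hence [xget] never falls back on its default. *)
Lemma ultra_weak_limit_proj q : ultra_weak_limit q (P q).
Proof.
suff [l ql] : exists l, ultra_weak_limit q l by exact: (xgetPex 0 (ex_intro _ l ql)).
have /asboolP[M hM] := linfty_funP (urepr q).
have [l ql] := reflexive_weak_limit U Vr hM.
exists l => y yq f; apply/cvg_rnormP => e e0.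
have d : rnorm (y i - urepr q i) @[i --> ultra_sets U] --> (0 : R).
  by apply/uclassP; rewrite yq ureprK.
have c0 : 0 < 2 * (rnorm f + 1) by have := rnorm_ge0 f; lra.
have e2 : 0 < e / 2 by lra.
move/cvgrPdist_lt: d => /(_ _ (divr_gt0 e0 c0)) d.
have /cvg_rnormP/(_ _ e2) ql' := ql f.
near=> i.
have h1 : rnorm (f (urepr q i) - f l) < e / 2 by near: i.
have : `|0 - rnorm (y i - urepr q i)| < e / (2 * (rnorm f + 1)) by near: i.
rewrite sub0r normrN ger0_norm ?rnorm_ge0// ltr_pdivlMr// => h2.
have h3 := dual_le f (y i - urepr q i); rewrite dualB in h3.
have := rnormD (f (y i) - f (urepr q i)) (f (urepr q i) - f l).
rewrite addrA subrK; have := rnorm_ge0 (y i - urepr q i); have := rnorm_ge0 f; nra.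
Unshelve. all: by end_near. Qed.

Lemma weak_limit_proj_class (x : linfty V I) (l : V) : weak_limit U x l -> P (uclass U x) = l.
Proof.
move=> xl; apply: weak_limit_unique xl.
exact: (@ultra_weak_limit_proj (uclass U x) x).
Qed.

Lemma weak_limit_proj_repr q : weak_limit U (urepr q) (P q).
Proof. by apply: ultra_weak_limit_proj; rewrite ureprK. Qed.

Lemma weak_limit_proj_linear (a : K) q r : P (a *: q + r) = a *: P q + P r.
Proof.
have e : a *: q + r = uclass U (a *: urepr q + urepr r).
  by rewrite uclassD ureprK -uscale_class ureprK.
rewrite e; apply: weak_limit_proj_class => f.
rewrite dual_linear.
have h := @cvg_linear_comb R k K^o I U _ a _ _ _ _
  (@weak_limit_proj_repr q f) (@weak_limit_proj_repr r f).
have fE : (fun i => f ((a *: urepr q + urepr r) i)) =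
    (fun i => a *: f (urepr q i) + f (urepr r i)).
  by apply/funext => i; exact: dual_linear.
by rewrite fE; exact: h.
Qed.

Lemma weak_limit_projB q r : P (q - r) = P q - P r.
Proof. by rewrite addrC -scaleN1r weak_limit_proj_linear scaleN1r addrC. Qed.

Lemma weak_limit_proj_diag (v : V) : P (diag_embed U v) = v.
Proof. by apply: weak_limit_proj_class => f; exact: cvg_cst. Qed.

Lemma rnorm_diag (v : V) : rnorm (diag_embed U v) = rnorm v.
Proof.
have := @rnorm_uclass R k V I U (linfty_cst I v) => h.
have c : rnorm (linfty_cst I v i) @[i --> ultra_sets U] --> rnorm v by exact: cvg_cst.
exact: (cvg_unique _ h c).
Qed.

Lemma rnorm_weak_limit_proj_le q : rnorm (P q) <= rnorm q.
Proof.
apply/ler_addgt0Pr => e e0; apply: rnorm_weak_limit_le (@weak_limit_proj_repr q) _.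
have : rnorm (uclass U (urepr q)) < rnorm q + e by rewrite ureprK ltrDl.
by move/rnorm_uclass_lt; apply: filterS => i /ltW.
Qed.

Lemma diag_linear (a : K) (v w : V) :
  diag_embed U (a *: v + w) = a *: diag_embed U v + diag_embed U w.
Proof.
have e : linfty_cst I (a *: v + w) = a *: linfty_cst I v + linfty_cst I w.
  by apply: val_inj; apply/funext.
rewrite /diag_embed e uclassD; congr (_ + _).
exact: (esym (uscale_class U a (linfty_cst I v))).
Qed.

Lemma diagB (v w : V) : diag_embed U (v - w) = diag_embed U v - diag_embed U w.
Proof. by rewrite addrC -scaleN1r diag_linear scaleN1r addrC. Qed.

Lemma weak_kernel_sub_proj q : weak_kernel V U (q - diag_embed U (P q)).
Proof. by rewrite /weak_kernel/= weak_limit_projB weak_limit_proj_diag subrr. Qed.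

Lemma weak_kernel_subspace : linear_subspace (weak_kernel V U).
Proof.
split.
  by rewrite /weak_kernel/= -[X in P X](subrr (diag_embed U 0)) weak_limit_projB subrr.
move=> a q r; rewrite /weak_kernel/= => q0 r0.
by rewrite weak_limit_proj_linear q0 r0 scaler0 addr0.
Qed.

Lemma weak_kernel_closed q :
  (forall e : R, 0 < e -> exists2 s, weak_kernel V U s & rnorm (q - s) < e) ->
  weak_kernel V U q.
Proof.
move=> h; apply: rnorm0_eq0; apply/eqP; rewrite eq_le rnorm_ge0 andbT.
apply/ler_addgt0Pr => e /h[s s0 qs]; rewrite add0r.
have -> : P q = P (q - s) by rewrite weak_limit_projB s0 subr0.
exact: le_trans (rnorm_weak_limit_proj_le _) (ltW qs).
Qed.

Lemma weak_kernel_direct_sum :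
  topological_direct_sum (range (@diag_embed R k V I U)) (weak_kernel V U).
Proof.
split; last first.
- exists (fun q => diag_embed U (P q)), (fun q => q - diag_embed U (P q)).
  have c : continuous (fun q => diag_embed U (P q)).
    apply: (@lipschitz_linear_continuous R k _ _ (fun q => diag_embed U (P q)) 1) => [q r|q].
      by rewrite weak_limit_projB diagB.
    by rewrite mul1r rnorm_diag rnorm_weak_limit_proj_le.
  have c' : continuous (fun q => q - diag_embed U (P q)).
    apply: (@lipschitz_linear_continuous R k _ _ (fun q => q - diag_embed U (P q)) 2) => [q r|q].
      rewrite weak_limit_projB diagB !opprB -!addrA; congr (q + _).
      by rewrite addrCA [RHS]addrCA (addrC (- r)).
    apply: le_trans (rnormD _ _) _; rewrite rnormN rnorm_diag.
    by have := rnorm_weak_limit_proj_le q; lra.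
  split=> // q.
  split; [by exists (P q)|exact: weak_kernel_sub_proj|by rewrite addrC subrK].
- apply/seteqP; split=> [_ [[v _ <-]]|_ ->].
    by rewrite /weak_kernel/= weak_limit_proj_diag => ->; rewrite -(subrr (0 : V)) diagB subrr.
  split; last exact: weak_kernel_subspace.1.
  by exists 0 => //; rewrite -(subrr (0 : V)) diagB subrr.
- exact: weak_kernel_subspace.
- split; first by exists 0 => //; rewrite -(subrr (0 : V)) diagB subrr.
  by move=> a _ _ [v _ <-] [w _ <-]; exists (a *: v + w) => //; exact: diag_linear.
Qed.

End ReflexiveUltrapower.

(** * Real inequalities *)

Section PowerInequalities.
Variable R : realType.
Implicit Types (q x y t : R).

(** After division by x + y both terms lie in [0, 1], where a power with exponent q >= 1 does not
    exceed its base. *)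
Lemma powR_superadditive q x y : 1 <= q -> 0 <= x -> 0 <= y ->
  x `^ q + y `^ q <= (x + y) `^ q.
Proof.
move=> q1 x0 y0; have q0 : 0 < q by lra.
have [s0|s0] := eqVneq (x + y) 0.
  have [-> ->] : x = 0 /\ y = 0 by split; lra.
  by rewrite addr0 powR0 ?gt_eqF// addr0.
have sp : 0 < x + y by rewrite lt_neqAle eq_sym s0 addr_ge0.
have h (z : R) : 0 <= z <= x + y -> z `^ q <= (x + y) `^ q * (z / (x + y)).
  move=> /andP[z0 zs]; have [->|z1] := eqVneq z 0; first by rewrite powR0 ?gt_eqF// mul0r mulr0.
  have zp : 0 < z by rewrite lt_neqAle eq_sym z1.
  have ze : (x + y) * (z / (x + y)) = z by field; rewrite gt_eqF.
  have w0 : 0 <= z / (x + y) by rewrite divr_ge0// ltW.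
  have := powRM q (ltW sp) w0; rewrite ze => ->.
  rewrite ler_wpM2l ?powR_ge0//; apply: ge1r_powR => //.
  by rewrite divr_gt0// ler_pdivrMr// mul1r.
have hx : 0 <= x <= x + y by apply/andP; split; lra.
have hy : 0 <= y <= x + y by apply/andP; split; lra.
apply: le_trans (lerD (h _ hx) (h _ hy)) _.
by rewrite -mulrDr -mulrDl divff// mulr1.
Qed.

(** Convexity of the q-th power at the midpoint of x and y, rescaled by 2. *)
Lemma powR_mean q x y : 1 <= q -> 0 <= x -> 0 <= y ->
  (x + y) `^ q <= 2 `^ (q - 1) * (x `^ q + y `^ q).
Proof.
move=> q1 x0 y0; have q0 : 0 < q by lra.
have h2 : (0 : R) <= 2^-1 by lra.
have h2' : (2^-1 : R) <= 1 by lra.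
have := @convex_powR R q q1 (Itv01 h2 h2') x y.
rewrite !inE/= !in_itv/= !andbT => /(_ x0 y0).
rewrite !convRE /= => h.
have -> : x + y = 2 * (2^-1 * x + (1 - 2^-1) * y) by field.
rewrite powRM; [|by lra|by lra].
rewrite powRB; last by rewrite pnatr_eq0 implybT.
rewrite powRr1//.
have c0 : 0 < 2 `^ q :> R by rewrite powR_gt0.
have -> : 2 `^ q / 2 * (x `^ q + y `^ q) = 2 `^ q * (2^-1 * x `^ q + (1 - 2^-1) * y `^ q).
  by field.
by rewrite ler_pM2l.
Qed.

Lemma powR_sqr x : 0 <= x -> x `^ 2 = x ^+ 2.
Proof. by move=> x0; rewrite -powR_mulrn. Qed.

(* The constant comes from comparing the l_p and the l_2 norm of R^2 on both
   sides; it tends to 2 when p tends to 2 and a tends to 1. *)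
Lemma powR_parallelogram (p a A B x y : R) : 1 <= p -> 0 <= a -> 0 <= A -> 0 <= B ->
  0 <= x -> 0 <= y -> A ^+ 2 + B ^+ 2 <= 2 * a * (x ^+ 2 + y ^+ 2) ->
  A `^ p + B `^ p <= (2 * a) `^ (p / 2) * 2 `^ `|p / 2 - 1| * (x `^ p + y `^ p).
Proof.
move=> p1 a0 A0 B0 x0 y0 h; have p0 : 0 < p by lra.
have a20 : 0 <= 2 * a by rewrite mulr_ge0.
have mono (u v r : R) : 0 <= r -> 0 <= u -> u <= v -> u `^ r <= v `^ r.
  move=> r0 u0 uv; have := @ge0_ler_powR R r r0 u v.
  by rewrite !nnegrE; apply => //; exact: le_trans uv.
have [p2|p2] := leP 2 p.
  have q1 : 1 <= p / 2 by lra.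
  have E (z : R) : 0 <= z -> z `^ p = (z ^+ 2) `^ (p / 2).
    by move=> z0; rewrite -powR_sqr// -powRrM; congr powR; field.
  rewrite ger0_norm; last by lra.
  rewrite !E//; apply: le_trans (powR_superadditive q1 _ _) _; rewrite ?sqr_ge0//.
  have q0 : 0 <= p / 2 by lra.
  apply: le_trans (mono _ _ _ q0 _ h) _; first by rewrite addr_ge0 ?sqr_ge0.
  rewrite powRM ?addr_ge0 ?sqr_ge0// -mulrA ler_wpM2l ?powR_ge0//.
  by apply: powR_mean; rewrite ?sqr_ge0.
(* For p < 2 the two comparisons change sides: the mean inequality bounds A and B, superadditivity
   bounds x and y, both with exponent 2/p. The result is then raised to the power p/2. *)
have q1 : 1 <= 2 / p by rewrite ler_pdivlMr//; lra.
have E (z : R) : 0 <= z -> z ^+ 2 = (z `^ p) `^ (2 / p).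
  move=> z0; rewrite -powR_sqr// -powRrM; congr powR; field; rewrite gt_eqF//.
have cancel (z : R) : 0 <= z -> z = (z `^ (2 / p)) `^ (p / 2).
  move=> z0; rewrite -powRrM (_ : 2 / p * (p / 2) = 1) ?powRr1//.
  by field; rewrite gt_eqF.
rewrite ler0_norm; last by lra.
have S0 : 0 <= A `^ p + B `^ p by rewrite addr_ge0 ?powR_ge0.
have T0 : 0 <= x `^ p + y `^ p by rewrite addr_ge0 ?powR_ge0.
have q0 : 0 <= p / 2 by lra.
rewrite (cancel _ S0) [in leRHS](cancel _ T0).
have h1 := powR_mean q1 (powR_ge0 A p) (powR_ge0 B p).
have h2 := powR_superadditive q1 (powR_ge0 x p) (powR_ge0 y p).
rewrite -!E// in h1 h2.
have h3 : (A `^ p + B `^ p) `^ (2 / p) <=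
    2 `^ (2 / p - 1) * (2 * a) * (x `^ p + y `^ p) `^ (2 / p).
  apply: le_trans h1 _; rewrite -mulrA ler_wpM2l ?powR_ge0//.
  by apply: le_trans h _; rewrite ler_wpM2l.
apply: le_trans (mono _ _ _ q0 (powR_ge0 _ _) h3) _.
have c0 : 0 <= 2 `^ (2 / p - 1) :> R by exact: powR_ge0.
rewrite (powRM _ (mulr_ge0 c0 a20) (powR_ge0 _ _)) (powRM _ c0 a20) -powRrM.
rewrite [_ * (2 * a) `^ _]mulrC (_ : (2 / p - 1) * (p / 2) = - (p / 2 - 1))//.
by field; rewrite gt_eqF.
Qed.

Lemma powR_cvg (u v : nat -> R) (a b : R) : 0 < a ->
  u n @[n --> \oo] --> a -> v n @[n --> \oo] --> b -> u n `^ v n @[n --> \oo] --> a `^ b.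
Proof.
move=> a0 ua vb.
have h : expR (v n * ln (u n)) @[n --> \oo] --> expR (b * ln a).
  have lu : ln (u n) @[n --> \oo] --> ln a := cvg_comp _ _ ua (continuous_ln a0).
  exact: cvg_comp _ _ (cvgM vb lu) (@continuous_expR R _).
have -> : a `^ b = expR (b * ln a) by rewrite /powR gt_eqF.
have e : \forall n \near \oo, expR (v n * ln (u n)) = u n `^ v n.
  have h0 : \forall n \near \oo, 0 < u n := @cvgr_gt _ _ _ _ _ _ ua _ a0.
  case: h0 => N _ hN; exists N => // n /hN un0.
  by rewrite /powR gt_eqF.
exact: cvg_trans (near_eq_cvg e) h.
Qed.

Lemma parallelogram_constant_cvg (a v : nat -> R) :
  a n @[n --> \oo] --> (1 : R) -> v n @[n --> \oo] --> (2 : R) ->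
  (2 * a n) `^ (v n / 2) * (2 : R) `^ `|v n / 2 - 1 : R| @[n --> \oo] --> (2 : R).
Proof.
move=> a1 v2.
have h1 : (2 * a n) `^ (v n / 2) @[n --> \oo] --> (2 * 1) `^ (2 / 2).
  apply: powR_cvg; first by lra.
    exact: cvgMr.
  exact: cvgMl.
have h2 : (2 : R) `^ `|v n / 2 - 1 : R| @[n --> \oo] --> (2 : R) `^ `|2 / 2 - 1 : R|.
  apply: powR_cvg; [by lra|exact: cvg_cst|].
  apply: cvg_norm; apply: cvgB; [exact: cvgMl|exact: cvg_cst].
have two : (2 * 1 : R) `^ (2 / 2) * 2 `^ `|2 / 2 - 1 : R| = 2.
  by rewrite divff// subrr normr0 powRr0 !mulr1 powRr1.
have h3 := cvgM h1 h2; rewrite two in h3.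
exact: h3.
Qed.

End PowerInequalities.

(** * The modular of the ultrapower *)

Lemma cvg_of_diff_null (R : realType) (T : Type) (F : set_system T) (FF : ProperFilter F)
    (f g : T -> R) (l : R) :
  f x @[x --> F] --> l -> f x - g x @[x --> F] --> (0 : R) -> g x @[x --> F] --> l.
Proof.
move=> fl fg; have h := cvgB fl fg; rewrite subr0 in h.
have e : g = f - (f - g) by apply/funext => x; rewrite [RHS]subKr.
by rewrite e; exact: h.
Qed.

Lemma dist_le_of_le (R : realType) (a b c e : R) :
  a <= b + c -> b <= a + c -> c <= e -> `|a - b| <= e.
Proof. by move=> h1 h2 h3; rewrite ler_norml; apply/andP; split; lra. Qed.

Lemma convex_comb_le (R : realType) (s a b c C : R) : 0 < s ->
  a <= s * b + (1 - s) * c -> b <= C -> 0 <= c -> a <= c + s * C.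
Proof. nra. Qed.

Section NakanoUltrapower.
Variables (R : realType) (k : scalar_kind) (p : exponents R).
Local Notation K := (scalar_field R k).
Variable E_ : nat -> normedModType K.
Hypothesis p_cvg : p n @[n --> \oo] --> (2 : R).
Hypothesis E_findim : forall n, finite_dimensional (E_ n).
Local Notation E := (nakano_sum p E_).
Local Notation Theta := (modular_fun (nakano_modular p E_)).
Variables (I : Type) (U : ultrafilter I).
Local Notation EU := (@ultrapower R k E I U).
Local Notation ThetaU := (@ultra_modular R k E I U Theta).
Implicit Types (x y z : E) (u v w : linfty E I) (q r h : EU).

(** Convexity along x = s (y + w) + (1 - s) y, where w = (x - y)/s has norm below 1, so that y + w
    has norm below M + 1 and modular at most (M + 1)^P. *)
Lemma theta_lipschitz (P M s : R) x y : (forall n, p n <= P) -> 0 < s <= 1 ->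
  rnorm (x - y) < s -> rnorm y < M -> Theta x <= Theta y + s * (M + 1) `^ P.
Proof.
move=> pP /andP[s0 s1] xys yM.
pose w : E := of_real s^-1 *: (x - y).
have w1 : rnorm w < 1.
  by rewrite rnorm_scaled ?invr_ge0 ?(ltW s0)// ltr_pdivrMl// mulr1.
have xE : x = of_real s *: (y + w) + of_real (1 - s) *: y.
  rewrite scalerDr rmorphB rmorph1 scalerBl scale1r /w scalerA -rmorphM divff ?gt_eqF//.
  by rewrite rmorph1 scale1r addrAC [_ + (y - _)]addrC subrK [RHS]addrC subrK.
have M0 : 0 < M by exact: le_lt_trans (rnorm_ge0 y) yM.
have yw : rnorm (y + w) < M + 1 by apply: le_lt_trans (rnormD _ _) _; exact: ltrD.
have M1 : 1 <= M + 1 by rewrite lerDr ltW.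
have h1 := theta_le_rnorm pP M1 yw.
have s01 : 0 <= s <= 1 by rewrite (ltW s0).
have h2 := modular_convex (nakano_modular p E_) (y + w) y s01.
have h3 : Theta x <= s * Theta (y + w) + (1 - s) * Theta y by rewrite {1}xE; exact: h2.
exact: convex_comb_le s0 h3 h1 (theta_ge0 y).
Qed.

Lemma theta_near_le (P M s : R) u v : (forall n, p n <= P) -> 0 < s <= 1 ->
  rnorm (uclass U u - uclass U v) < s -> rnorm (uclass U v) < M ->
  \forall i \near ultra_sets U, Theta (u i) <= Theta (v i) + s * (M + 1) `^ P.
Proof.
move=> pP s01; rewrite -uclassB => /rnorm_uclass_lt h1 /rnorm_uclass_lt h2.
apply: filterS (filterI h1 h2) => i [h1i h2i]; rewrite linftyB in h1i.
exact: theta_lipschitz pP s01 h1i h2i.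
Qed.

Lemma theta_family_cvg u : cvg (Theta (u i) @[i --> ultra_sets U]).
Proof.
have /asboolP[M hM] := linfty_funP u; have [P P1 pP] := exponent_max p.
apply: (@ultra_bounded_cvg _ _ _ _ ((`|M| + 2) `^ P)) => i.
rewrite ger0_norm; last exact: theta_ge0.
apply: theta_le_rnorm pP _ _; first by have := normr_ge0 M; lra.
by have := hM i; have := ler_norm M; lra.
Qed.

(** The modular of a class is read off a chosen representative; the Lipschitz bound, with s
    arbitrarily small, shows that every representative gives the same limit. *)
Lemma ultra_modular_class u : Theta (u i) @[i --> ultra_sets U] --> ThetaU (uclass U u).
Proof.
have [P P1 pP] := exponent_max p.
set v := urepr (uclass U u).
have vu : uclass U v = uclass U u by rewrite ureprK.
have h0 : Theta (v i) - Theta (u i) @[i --> ultra_sets U] --> (0 : R).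
  apply/cvgrPdist_le => e e0.
  pose M := rnorm (uclass U u) + 1.
  have M0 : 0 < M by rewrite /M; have := rnorm_ge0 (uclass U u); lra.
  have C0 : 0 < (M + 1) `^ P by rewrite powR_gt0//; lra.
  pose s := Num.min 1 (e / (M + 1) `^ P).
  have s0 : 0 < s by rewrite lt_min ltr01 divr_gt0.
  have s01 : 0 < s <= 1 by rewrite s0 ge_min lexx.
  have sC : s * (M + 1) `^ P <= e by rewrite -ler_pdivlMr// ge_min lexx orbT.
  have uM : rnorm (uclass U u) < M by rewrite ltrDl.
  have vM : rnorm (uclass U v) < M by rewrite vu.
  have h1 : rnorm (uclass U u - uclass U v) < s by rewrite vu subrr rnorm0.
  have h2 : rnorm (uclass U v - uclass U u) < s by rewrite vu subrr rnorm0.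
  apply: filterS (filterI (theta_near_le pP s01 h1 vM) (theta_near_le pP s01 h2 uM)).
  move=> i [a1 a2]; rewrite sub0r normrN; exact: dist_le_of_le a2 a1 sC.
have h1 : Theta (v i) @[i --> ultra_sets U] --> ThetaU (uclass U u) by exact: theta_family_cvg.
exact: cvg_of_diff_null h1 h0.
Qed.

Lemma ultra_modular_diag x : ThetaU (diag_embed U x) = Theta x.
Proof.
have h : Theta (linfty_cst I x i) @[i --> ultra_sets U] --> Theta x by exact: cvg_cst.
exact: (cvg_unique _ (@ultra_modular_class (linfty_cst I x)) h).
Qed.

Lemma ultra_modular_le (a b : R) u v :
  (\forall i \near ultra_sets U, Theta (u i) <= a * Theta (v i) + b) ->
  ThetaU (uclass U u) <= a * ThetaU (uclass U v) + b.
Proof.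
move=> h; rewrite -subr_ge0.
have c : a * Theta (v i) + b - Theta (u i) @[i --> ultra_sets U] -->
    a * ThetaU (uclass U v) + b - ThetaU (uclass U u).
  apply: cvgB; last exact: ultra_modular_class.
  by apply: cvgD; [apply: cvgMr; exact: ultra_modular_class|exact: cvg_cst].
apply: (cvgr_to_ge c); apply: filterS h => i hi.
by rewrite subr_ge0.
Qed.

Lemma ultra_modular_lipschitz (P M s : R) q r : (forall n, p n <= P) -> 0 < s <= 1 ->
  rnorm (q - r) < s -> rnorm r < M -> ThetaU q <= ThetaU r + s * (M + 1) `^ P.
Proof.
move=> pP s01; rewrite -(ureprK q) -(ureprK r) => qr rM.
have := @ultra_modular_le 1 (s * (M + 1) `^ P) (urepr q) (urepr r).
rewrite mul1r; apply; apply: filterS (theta_near_le pP s01 qr rM) => i.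
by rewrite mul1r.
Qed.

Lemma weakly_null_trunc u N : weak_limit U u 0 ->
  rnorm (trunc N (u i)) @[i --> ultra_sets U] --> (0 : R).
Proof.
move=> u0; have [l hl] := trunc_system p E_findim N.
have h : \sum_(e <- l) rnorm (e.2 (u i)) * rnorm e.1 @[i --> ultra_sets U] --> (0 : R).
  elim: l {hl} => [|e l IH].
    rewrite (_ : (fun i => _) = (fun=> 0)); first exact: cvg_cst.
    by apply/funext => i; rewrite big_nil.
  have eu : rnorm (e.2 (u i)) @[i --> ultra_sets U] --> (0 : R).
    have /cvg_rnorm0P := u0 e.2; rewrite dual0.
    by under eq_fun do rewrite subr0.
  have h1 : rnorm (e.2 (u i)) * rnorm e.1 @[i --> ultra_sets U] --> 0 * rnorm e.1.
    exact: cvgMl.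
  have h2 := cvgD h1 IH; rewrite mul0r addr0 in h2.
  rewrite (_ : (fun i => _) = (fun i => rnorm (e.2 (u i)) * rnorm e.1 +
    \sum_(e <- l) rnorm (e.2 (u i)) * rnorm e.1)); first exact: h2.
  by apply/funext => i; rewrite big_cons.
apply: null_pred_squeeze h => i; rewrite rnorm_ge0 hl.
apply: le_trans (rnorm_sum _ _ _) _; apply: ler_sum => e _.
by rewrite rnormZ.
Qed.

Lemma linfty_tail_subproof N u : (fun i => tail N (u i)) \in @linfty_pred R k E I.
Proof.
have /asboolP[M hM] := linfty_funP u; apply/asboolP; exists M => i.
exact: le_trans (rnorm_tail_le N (u i)) (hM i).
Qed.

Definition linfty_tail N u : linfty E I := Linfty (linfty_tail_subproof N u).

Lemma uclass_tail N u : weak_limit U u 0 -> uclass U (linfty_tail N u) = uclass U u.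
Proof.
move=> /(weakly_null_trunc N) h; apply/uclassP.
have e i : rnorm (linfty_tail N u i - u i) = rnorm (trunc N (u i)).
  have -> : linfty_tail N u i - u i = - trunc N (u i)
    by rewrite (_ : linfty_tail N u i = u i - trunc N (u i))// addrAC subrr add0r.
  by rewrite rnormN.
by rewrite (funext e).
Qed.

End NakanoUltrapower.

Section RealEstimates.
Variable R : realType.

Lemma eq_of_small_dist (a b C : R) : 0 <= C ->
  (forall s : R, 0 < s <= 1 -> `|a - b| <= s * C) -> a = b.
Proof.
move=> C0 h; apply/eqP; rewrite -subr_eq0 -normr_le0; apply/ler_addgt0Pr => e e0.
rewrite add0r; have C1 : 0 < C + 1 by lra.
pose s := Num.min 1 (e / (C + 1)).
have s0 : 0 < s by rewrite lt_min ltr01 divr_gt0.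
have s01 : 0 < s <= 1 by rewrite s0 ge_min lexx.
have sC : s * (C + 1) <= e by rewrite -ler_pdivlMr// ge_min lexx orbT.
by have := h s s01; nra.
Qed.

Lemma le_of_scale (a b c : R) : 0 <= b ->
  (forall e : R, 0 < e -> a <= (c + e) * b) -> a <= c * b.
Proof.
move=> b0 h; apply/ler_addgt0Pr => e e0.
have b1 : 0 < b + 1 by lra.
have h1 := h (e / (b + 1)) (divr_gt0 e0 b1).
have h2 : e / (b + 1) * (b + 1) = e by field; rewrite gt_eqF.
have h3 : 0 < e / (b + 1) by rewrite divr_gt0.
by nra.
Qed.

Lemma dist_add_le (a b c d s x y : R) : `|a - (d + b)| <= s * c -> x = d + y ->
  0 <= y -> y < s -> `|a - (x + b)| <= s * (c + 1).
Proof.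
rewrite !ler_norml => /andP[h1 h2] h3 h4 h5.
by apply/andP; split; lra.
Qed.

Lemma sqr_eq_of_bounds (a b : R) : 0 <= a -> 0 <= b ->
  (forall t, b < t -> a <= t ^+ 2) -> (forall t, 0 < t -> t < b -> t ^+ 2 <= a) ->
  a = b ^+ 2.
Proof.
move=> a0 b0 up lo; have sa : a = Num.sqrt a ^+ 2 by rewrite sqr_sqrtr.
set c := Num.sqrt a in sa; have c0 : 0 <= c by exact: sqrtr_ge0.
have [cb|bc|cb] := ltgtP c b; last by rewrite sa cb.
- have t0 : 0 < (c + b) / 2 by lra.
  have tb : (c + b) / 2 < b by lra.
  by have := lo _ t0 tb; rewrite sa; nra.
- have tb : b < (c + b) / 2 by lra.
  by have := up _ tb; rewrite sa; nra.
Qed.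

Lemma sqr_le_of_inv (t a : R) : 0 < t -> 1 <= t^-1 ^+ 2 * a -> t ^+ 2 <= a.
Proof. by move=> t0; rewrite exprVn ler_pdivlMl ?exprn_gt0// mulr1. Qed.

End RealEstimates.

(** * Additivity of the modular across the decomposition, and its value on the kernel *)

Section NakanoDecomposition.
Variables (R : realType) (k : scalar_kind) (p : exponents R).
Local Notation K := (scalar_field R k).
Variable E_ : nat -> normedModType K.
Hypothesis p_cvg : p n @[n --> \oo] --> (2 : R).
Hypothesis E_findim : forall n, finite_dimensional (E_ n).
Local Notation E := (nakano_sum p E_).
Local Notation Theta := (modular_fun (nakano_modular p E_)).
Variables (I : Type) (U : ultrafilter I).
Local Notation EU := (@ultrapower R k E I U).
Local Notation ThetaU := (@ultra_modular R k E I U Theta).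
Implicit Types (x y z : E) (u v w : linfty E I) (q r h : EU).

Let Er : reflexive_space E. Proof. exact: nakano_reflexive p_cvg E_findim. Qed.

Lemma weak_kernel_repr h : weak_kernel E U h -> weak_limit U (urepr h) 0.
Proof. by move=> h0; have := @weak_limit_proj_repr R k E I U Er h; rewrite h0. Qed.

Lemma weak_kernel_tail h N : weak_kernel E U h -> uclass U (linfty_tail N (urepr h)) = h.
Proof.
move=> /weak_kernel_repr h0.
exact: etrans (uclass_tail E_findim N h0) (ureprK h).
Qed.

Lemma ultra_modular_ge0 q : 0 <= ThetaU q.
Proof.
rewrite -(ureprK q); apply: (cvgr_to_ge (@ultra_modular_class R k p E_ I U (urepr q))).
by apply: (@filterE _ (ultra_sets U)) => i; exact: theta_ge0.
Qed.

(** The representative of h is cut at the same N as x, so the supports are disjoint for every index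
    and additivity holds exactly before the limit is taken. *)
Lemma ultra_modular_trunc_add x h N : weak_kernel E U h ->
  ThetaU (diag_embed U (trunc N x) + h) = Theta (trunc N x) + ThetaU h.
Proof.
move=> h0; set y := urepr h.
have e : diag_embed U (trunc N x) + h =
    uclass U (linfty_cst I (trunc N x) + linfty_tail N y).
  by rewrite uclassD weak_kernel_tail.
have c1 := @ultra_modular_class R k p E_ I U (linfty_cst I (trunc N x) + linfty_tail N y).
have c2 : Theta (trunc N x) + Theta (linfty_tail N y i) @[i --> ultra_sets U] -->
    Theta (trunc N x) + ThetaU (uclass U (linfty_tail N y)).
  by apply: cvgD; [exact: cvg_cst|exact: ultra_modular_class].
rewrite weak_kernel_tail// in c2; rewrite e.
have fE : (fun i => Theta ((linfty_cst I (trunc N x) + linfty_tail N y) i)) =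
    (fun i => Theta (trunc N x) + Theta (linfty_tail N y i)).
  by apply/funext => i; exact: theta_trunc_tail.
rewrite fE in c1; exact: (cvg_unique _ c1 c2).
Qed.

Lemma ultra_modular_add x h : weak_kernel E U h ->
  ThetaU (diag_embed U x + h) = Theta x + ThetaU h.
Proof.
move=> h0; have [P P1 pP] := exponent_max p.
pose M := rnorm x + rnorm h + 1.
(* Replacing x by a truncation costs s (M + 1)^P by the Lipschitz bound, M exceeding the norms of
   both sums, and less than s for the modular of the tail. *)
apply: (@eq_of_small_dist _ _ _ ((M + 1) `^ P + 1)).
  by rewrite addr_ge0 ?powR_ge0.
move=> s s01; have /andP[s0 s1] := s01.
have [N [t1 t2]] : exists N, rnorm (tail N x) < s /\ Theta (tail N x) < s.
  have A1 := rnorm_tail_cvg x s0.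
  have A2 : \forall N \near \oo, Theta (tail N x) < s.
    exact: (@cvgr_lt _ _ _ _ _ _ (@theta_tail_cvg R k p E_ x) _ s0).
  exact: (@filter_ex _ \oo _ _ (filterI A1 A2)).
have xE : Theta x = Theta (trunc N x) + Theta (tail N x).
  by rewrite -theta_trunc_tail -trunc_tail.
apply: dist_add_le xE (theta_ge0 _) t2.
rewrite -(ultra_modular_trunc_add x N h0).
set q := diag_embed U x + h; set r := diag_embed U (trunc N x) + h.
have qr : rnorm (q - r) = rnorm (tail N x).
  by rewrite /q /r opprD addrACA subrr addr0 -diagB rnorm_diag.
have qM : rnorm q < M.
  by apply: le_lt_trans (rnormD _ _) _; rewrite rnorm_diag /M ltrDl.
have rM : rnorm r < M.
  apply: le_lt_trans (rnormD _ _) _; rewrite rnorm_diag.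
  by apply: le_lt_trans (lerD (rnorm_trunc_le N x) (lexx _)) _; rewrite /M ltrDl.
have qrs : rnorm (q - r) < s by rewrite qr.
have rqs : rnorm (r - q) < s by rewrite -rnormN opprB.
apply: dist_le_of_le (ultra_modular_lipschitz pP s01 qrs rM)
  (ultra_modular_lipschitz pP s01 rqs qM) _.
exact: lexx.
Qed.

Lemma exponents_powR_le (t e : R) : 0 < t -> 0 < e ->
  exists N, forall n, (N <= n)%N -> t `^ p n <= t ^+ 2 + e.
Proof.
move=> t0 e0.
have h : t `^ p n @[n --> \oo] --> t `^ 2.
  by apply: powR_cvg => //; exact: cvg_cst.
rewrite powR_sqr ?ltW// in h; move/cvgrPdist_lt: h => /(_ e e0)[N _ hN].
exists N => n /hN /=; rewrite ltr_norml => /andP[h1 h2]; lra.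
Qed.

(** The representative is cut at an N beyond which t^(p n) <= t^2 + e, so the estimate holds entry
    by entry; then e tends to 0. *)
Lemma ultra_modular_scale_le (t : R) h : 0 < t -> weak_kernel E U h ->
  ThetaU (of_real t *: h) <= t ^+ 2 * ThetaU h.
Proof.
move=> t0 h0; apply: le_of_scale; first exact: ultra_modular_ge0.
move=> e e0; have [N hN] := exponents_powR_le t0 e0.
have c0 : 0 <= t ^+ 2 + e by rewrite addr_ge0 ?sqr_ge0// ltW.
set y := linfty_tail N (urepr h).
have yh : uclass U y = h by exact: weak_kernel_tail.
have := @ultra_modular_le R k p E_ I U (t ^+ 2 + e) 0 (of_real t *: y) y.
rewrite addr0 yh (_ : uclass U (of_real t *: y) = of_real t *: h); last first.
  by rewrite -yh; exact: (esym (uscale_class U _ y)).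
apply; apply: (@filterE _ (ultra_sets U)) => i; rewrite addr0.
apply: theta_le_scale => [|n]; first exact: c0.
rewrite linftyZ entryZ rnorm_scaled ?(ltW t0)// powRM ?rnorm_ge0 ?(ltW t0)//.
have -> : entry n (y i) = if (n < N)%N then 0 else entry n (urepr h i) by exact: entry_tail.
have [nN|nN] := ltnP n N.
  have z : (0 : R) `^ p n = 0 by rewrite powR0// gt_eqF// exponent_gt0.
  by rewrite rnorm0 z !mulr0.
by rewrite ler_wpM2r ?powR_ge0// hN.
Qed.

Lemma weak_kernelZ (a : K) h : weak_kernel E U h -> weak_kernel E U (a *: h).
Proof.
have [k0 kL] := @weak_kernel_subspace R k E I U Er.
by move=> h0; have := kL a _ _ h0 k0; rewrite addr0.
Qed.

(** The Luxemburg norm of E is compared with t index by index. If t exceeds the norm of h, then h/t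
    has modular at most 1, and scaling back by t bounds the modular of h by t^2. If t is below it,
    the modular of h/t is at least 1, and the scaling bound for 1/t gives the reverse estimate. *)
Lemma ultra_modular_weak_kernel h : weak_kernel E U h -> ThetaU h = rnorm h ^+ 2.
Proof.
move=> h0; apply: sqr_eq_of_bounds; [exact: ultra_modular_ge0|exact: rnorm_ge0| |].
- move=> t ht; have t0 : 0 < t by exact: le_lt_trans (rnorm_ge0 h) ht.
  have h1 : ThetaU (of_real t^-1 *: h) <= 1.
    rewrite -(ureprK h) in ht *.
    rewrite (_ : _ *: _ = uclass U (of_real t^-1 *: urepr h)); last exact: uscale_class.
    apply: (cvgr_to_le (@ultra_modular_class R k p E_ I U (of_real t^-1 *: urepr h))).
    by apply: filterS (rnorm_uclass_lt ht) => i hi; rewrite linftyZ; exact: rnorm_lt_theta hi.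
  have -> : h = of_real t *: (of_real t^-1 *: h).
    by rewrite scalerA -rmorphM divff ?gt_eqF// rmorph1 scale1r.
  apply: le_trans (ultra_modular_scale_le t0 (weak_kernelZ _ h0)) _.
  by rewrite ler_piMr ?sqr_ge0.
- move=> t t0 ht; have ti : 0 < t^-1 by rewrite invr_gt0.
  have h1 : 1 <= ThetaU (of_real t^-1 *: h).
    rewrite -(ureprK h) in ht *.
    rewrite (_ : _ *: _ = uclass U (of_real t^-1 *: urepr h)); last exact: uscale_class.
    apply: (cvgr_to_ge (@ultra_modular_class R k p E_ I U (of_real t^-1 *: urepr h))).
    apply: filterS (rnorm_uclass_gt ht) => i hi; rewrite linftyZ leNgt; apply/negP => hl.
    by have := rnorm_le_theta t0 (ltW hl); rewrite leNgt hi.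
  exact: sqr_le_of_inv t0 (le_trans h1 (ultra_modular_scale_le ti h0)).
Qed.

Lemma ultra_modular_decomposition x h : weak_kernel E U h ->
  ThetaU (diag_embed U x + h) = Theta x + rnorm h ^+ 2.
Proof. by move=> h0; rewrite ultra_modular_add// ultra_modular_weak_kernel. Qed.

Lemma nakano_modular_decomposition :
  modular_decomposition ThetaU (range (@diag_embed R k E I U)) (weak_kernel E U).
Proof.
split; first exact: weak_kernel_direct_sum Er.
move=> _ h [x _ <-] h0; rewrite ultra_modular_add//.
by rewrite ultra_modular_diag.
Qed.

End NakanoDecomposition.

(** * The parallelogram law on the kernel *)

Section RealArithmetic.
Variable R : realType.

Lemma parallelogram_congr (a b c d a' b' c' d' : R) : a' = a -> b' = b -> c' = c -> d' = d ->
  a' + b' <= 2 * (c' + d') -> a + b <= 2 * (c + d).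
Proof. by move=> -> -> -> ->. Qed.

Lemma eq_of_double_le (a b c d : R) : a + b <= 2 * (c + d) ->
  4 * c + 4 * d <= 2 * (a + b) -> a + b = 2 * (c + d).
Proof. lra. Qed.

Lemma limit_sum_le (T : Type) (F : set_system T) (FF : ProperFilter F)
    (f1 f2 f3 f4 : T -> R) (l1 l2 l3 l4 c : R) :
  f1 x @[x --> F] --> l1 -> f2 x @[x --> F] --> l2 ->
  f3 x @[x --> F] --> l3 -> f4 x @[x --> F] --> l4 ->
  (forall x, f3 x + f4 x <= c * (f1 x + f2 x)) -> l3 + l4 <= c * (l1 + l2).
Proof.
move=> h1 h2 h3 h4 h; rewrite -subr_ge0.
have h5 : c * (f1 x + f2 x) - (f3 x + f4 x) @[x --> F] --> c * (l1 + l2) - (l3 + l4).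
  by apply: cvgB; [apply: cvgMr; exact: cvgD|exact: cvgD].
by apply: (cvgr_to_ge h5); apply: filterE => x; rewrite subr_ge0.
Qed.

End RealArithmetic.

Section JordanVonNeumannConstant.
Variables (R : realType) (k : scalar_kind) (V : normedModType (scalar_field R k)).

Lemma jordan_von_neumann_ineq (x y : V) :
  rnorm (x + y) ^+ 2 + rnorm (x - y) ^+ 2 <=
  2 * jordan_von_neumann V * (rnorm x ^+ 2 + rnorm y ^+ 2).
Proof.
rewrite /jordan_von_neumann; set S := [set r | _].
have Sub : has_ubound S.
  (* Each of the two squares is at most (|u| + |v|)^2, hence at most 2 (|u|^2 + |v|^2) = 2. *)
  exists 4 => _ [u [v [uv ->]]].
  have h1 := rnormD u v; have h2 := rnormD u (- v); rewrite rnormN in h2.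
  have sq (c d : R) : 0 <= c -> c <= d -> c ^+ 2 <= d ^+ 2 by move=> c0 cd; nra.
  have h3 := sq _ _ (rnorm_ge0 _) h1; have h4 := sq _ _ (rnorm_ge0 _) h2.
  have h5 : (rnorm u + rnorm v) ^+ 2 <= 2 * (rnorm u ^+ 2 + rnorm v ^+ 2).
    by have := sqr_ge0 (rnorm u - rnorm v); nra.
  lra.
set s2 := rnorm x ^+ 2 + rnorm y ^+ 2.
have s20 : 0 <= s2 by rewrite addr_ge0 ?sqr_ge0.
have [s0|s0] := eqVneq s2 0.
  move/eqP: (s0); rewrite /s2 paddr_eq0 ?sqr_ge0// => /andP[x2 y2].
  have -> : x = 0 by apply: rnorm0_eq0; apply/eqP; rewrite -sqrf_eq0.
  have -> : y = 0 by apply: rnorm0_eq0; apply/eqP; rewrite -sqrf_eq0.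
  by rewrite ?s0 ?/s2 addr0 subr0 !rnorm0 !expr0n/= !addr0 mulr0.
have sp : 0 < s2 by rewrite lt_neqAle eq_sym s0.
pose s := Num.sqrt s2; have ss : s ^+ 2 = s2 by rewrite sqr_sqrtr.
have s1 : 0 < s by rewrite sqrtr_gt0.
have si : 0 <= s^-1 by rewrite invr_ge0 ltW.
have nZ (z : V) : rnorm (of_real s^-1 *: z) ^+ 2 = rnorm z ^+ 2 / s2.
  by rewrite rnormZ re_norm_of_real// exprMn exprVn ss mulrC.
have Sr : S ((rnorm (x + y) ^+ 2 + rnorm (x - y) ^+ 2) / s2).
  exists (of_real s^-1 *: x), (of_real s^-1 *: y).
  by rewrite -scalerDr -scalerBr !nZ -!mulrDl divff.
have := ub_le_sup Sub Sr; rewrite ler_pdivrMr// => /le_trans; apply.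
by rewrite mulrA divff ?mul1r.
Qed.

(* The inequality for (x, y), applied to (x + y, x - y), is its own converse. *)
Lemma parallelogram_of_le (S : set V) : linear_subspace S ->
  (forall x y, S x -> S y ->
    rnorm (x + y) ^+ 2 + rnorm (x - y) ^+ 2 <= 2 * (rnorm x ^+ 2 + rnorm y ^+ 2)) ->
  forall x y, S x -> S y ->
    rnorm (x + y) ^+ 2 + rnorm (x - y) ^+ 2 = 2 * (rnorm x ^+ 2 + rnorm y ^+ 2).
Proof.
move=> [_ SL] h x y Sx Sy.
have SD : S (x + y) by rewrite addrC -[y]scale1r; exact: SL.
have SB : S (x - y) by rewrite addrC -scaleN1r; exact: SL.
have dbl (z : V) : rnorm (z + z) ^+ 2 = 4 * rnorm z ^+ 2.
  rewrite -[z + z]mulr2n -scaler_nat (_ : 2%:R = of_real 2 :> scalar_field R k).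
    by rewrite rnorm_scaled// exprMn; congr (_ * _); rewrite -natrX.
  by rewrite rmorph_nat.
have h1 := h _ _ Sx Sy; have h2 := h _ _ SD SB.
have e1 : x + y + (x - y) = x + x by rewrite addrACA subrr addr0.
have e2 : x + y - (x - y) = y + y by rewrite opprB addrC addrA subrK.
rewrite e1 e2 !dbl in h2.
exact: eq_of_double_le h1 h2.
Qed.

End JordanVonNeumannConstant.

Section AsymptoticallyHilbertian.
Variables (R : realType) (k : scalar_kind) (p : exponents R).
Local Notation K := (scalar_field R k).
Variable E_ : nat -> normedModType K.
Hypothesis p_cvg : p n @[n --> \oo] --> (2 : R).
Hypothesis E_findim : forall n, finite_dimensional (E_ n).
Hypothesis jvn_cvg : jordan_von_neumann (E_ n) @[n --> \oo] --> (1 : R).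
Local Notation E := (nakano_sum p E_).
Local Notation Theta := (modular_fun (nakano_modular p E_)).

Lemma eventually_parallelogram (e : R) : 0 < e -> exists N, forall n, (N <= n)%N ->
  forall a b : E_ n, rnorm (a + b) `^ p n + rnorm (a - b) `^ p n <=
    (2 + e) * (rnorm a `^ p n + rnorm b `^ p n).
Proof.
move=> e0; pose a n := jordan_von_neumann (E_ n).
have /cvgrPdist_lt/(_ e e0)[N1 _ hN1] := parallelogram_constant_cvg jvn_cvg p_cvg.
(* Beyond N2 the constant of the block lies within 1 of its limit 1 and is therefore positive, as
   the power inequality asks. *)
move/cvgrPdist_lt: jvn_cvg => /(_ 1 ltr01)[N2 _ hN2].
exists (maxn N1 N2) => n; rewrite geq_max => /andP[/hN1/= n1 /hN2/= n2] x y.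
have a0 : 0 <= a n by move: n2; rewrite -/(a n) ltr_norml => /andP[_ n2]; lra.
have := powR_parallelogram (exponent_ge1 p n) a0 (rnorm_ge0 _) (rnorm_ge0 _)
  (rnorm_ge0 _) (rnorm_ge0 _) (jordan_von_neumann_ineq x y).
move/le_trans; apply; apply: ler_wpM2r; first by rewrite addr_ge0 ?powR_ge0.
by move: n1; rewrite ltr_norml => /andP[n1 _]; lra.
Qed.

Lemma theta_sum_le (c : R) (x y z w : E) : 0 <= c ->
  (forall n, rnorm (entry n z) `^ p n + rnorm (entry n w) `^ p n <=
     c * (rnorm (entry n x) `^ p n + rnorm (entry n y) `^ p n)) ->
  Theta z + Theta w <= c * (Theta x + Theta y).
Proof.
move=> c0 h.
have zw : psum p N (entries z) + psum p N (entries w) @[N --> \oo] --> Theta z + Theta w.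
  by apply: cvgD; exact: psum_cvg.
apply: (cvgr_to_le zw); exists 0%N => // N _.
apply: (@le_trans _ _ (c * (psum p N (entries x) + psum p N (entries y)))).
  rewrite /psum [X in X <= _](_ : _ =
      \sum_(n < N) (rnorm (entry n z) `^ p n + rnorm (entry n w) `^ p n)).
    by rewrite -big_split mulr_sumr; apply: ler_sum => n _; exact: h.
  by rewrite big_split.
by rewrite ler_wpM2l// lerD// psum_le_theta.
Qed.

Variables (I : Type) (U : ultrafilter I).
Local Notation EU := (@ultrapower R k E I U).
Local Notation ThetaU := (@ultra_modular R k E I U Theta).

Let Er : reflexive_space E. Proof. exact: nakano_reflexive p_cvg E_findim. Qed.

(** Squared norms on the kernel are values of the modular, hence limits of sums over blocks. With
    tails as representatives only blocks beyond N contribute, and there the inequality holds with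
    constant 2 + e. *)
Lemma weak_kernel_parallelogram_le (g h : EU) : weak_kernel E U g -> weak_kernel E U h ->
  rnorm (g + h) ^+ 2 + rnorm (g - h) ^+ 2 <= 2 * (rnorm g ^+ 2 + rnorm h ^+ 2).
Proof.
move=> g0 h0; have [_ kL] := @weak_kernel_subspace R k E I U Er.
have gD : weak_kernel E U (g + h) by rewrite addrC -[h]scale1r; exact: kL.
have gB : weak_kernel E U (g - h) by rewrite addrC -scaleN1r; exact: kL.
apply: (parallelogram_congr (ultra_modular_weak_kernel p_cvg E_findim gD)
  (ultra_modular_weak_kernel p_cvg E_findim gB)
  (ultra_modular_weak_kernel p_cvg E_findim g0)
  (ultra_modular_weak_kernel p_cvg E_findim h0)).
apply: le_of_scale; first by rewrite addr_ge0 ?ultra_modular_ge0.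
move=> e e0; have [N hN] := eventually_parallelogram e0.
set x := linfty_tail N (urepr g); set y := linfty_tail N (urepr h).
have xg : uclass U x = g by exact: (weak_kernel_tail p_cvg E_findim).
have yh : uclass U y = h by exact: (weak_kernel_tail p_cvg E_findim).
have c1 := @ultra_modular_class R k p E_ I U x.
have c2 := @ultra_modular_class R k p E_ I U y.
have c3 := @ultra_modular_class R k p E_ I U (x + y).
have c4 := @ultra_modular_class R k p E_ I U (x - y).
rewrite uclassD xg yh in c3; rewrite uclassB xg yh in c4.
rewrite xg in c1; rewrite yh in c2.
have c0 : 0 <= 2 + e by rewrite addr_ge0 ?ltW.
apply: limit_sum_le c1 c2 c3 c4 _ => i; apply: theta_sum_le c0 _ => n.
rewrite linftyD linftyB entryD entryB.
have xE : entry n (x i) = if (n < N)%N then 0 else entry n (urepr g i) by exact: entry_tail.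
have yE : entry n (y i) = if (n < N)%N then 0 else entry n (urepr h i) by exact: entry_tail.
have [nN|nN] := ltnP n N.
  have z : (0 : R) `^ p n = 0 by rewrite powR0// gt_eqF// exponent_gt0.
  by rewrite xE yE nN addr0 subr0 rnorm0 z addr0 mulr0.
exact: hN.
Qed.

End AsymptoticallyHilbertian.

Section NakanoMain.
Variables (R : realType) (k : scalar_kind) (p : exponents R).
Variable E_ : nat -> normedModType (scalar_field R k).
Hypothesis p_cvg : p n @[n --> \oo] --> (2 : R).
Hypothesis E_findim : forall n, finite_dimensional (E_ n).
Local Notation E := (nakano_sum p E_).

Lemma nakano_banach : banach_space E.
Proof.
apply: banach_of_weak_limits => I U x M xM.
exact: reflexive_weak_limit (nakano_reflexive p_cvg E_findim) xM.
Qed.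

Lemma weak_kernel_hilbert (I : Type) (U : ultrafilter I) :
  jordan_von_neumann (E_ n) @[n --> \oo] --> (1 : R) ->
  isometric_to_hilbert (weak_kernel E U).
Proof.
move=> jvn; have Er := nakano_reflexive p_cvg E_findim.
have kS : linear_subspace (weak_kernel E U) by exact: weak_kernel_subspace Er.
apply: (isometric_to_hilbert_subspace kS).
- exact: ultrapower_complete nakano_banach.
- exact: weak_kernel_closed.
- apply: (parallelogram_of_le kS) => g h.
  exact: weak_kernel_parallelogram_le.
Qed.

End NakanoMain.

Theorem proposition3p1 (R : realType) (k : scalar_kind) (p : exponents R)
    (E_ : nat -> normedModType (scalar_field R k))
    (p_cvg : p n @[n --> \oo] --> (2 : R))
    (E_findim : forall n, finite_dimensional (E_ n))
    (E_nonzero : forall n, exists x : E_ n, x != 0) :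
  let E := nakano_sum p E_ in
  let Theta : E -> R := nakano_modular p E_ in
  (forall (I : Type) (U : ultrafilter I),
    [/\ forall q : ultrapower E U, ultra_weak_limit q (weak_limit_proj q),
        modular_decomposition (ultra_modular U Theta)
          (range (@diag_embed R k E I U)) (weak_kernel E U)
      & forall (x : E) (h : ultrapower E U), weak_kernel E U h ->
          ultra_modular U Theta (diag_embed U x + h) = Theta x + rnorm h ^+ 2])
  /\
  (jordan_von_neumann (E_ n) @[n --> \oo] --> (1 : R) ->
    (forall (I : Type) (U : ultrafilter I),
      isometric_to_hilbert (weak_kernel E U)) /\
    asymptotically_hilbertian E).
Proof.
move=> E Theta; have Er := nakano_reflexive p_cvg E_findim.
split=> [I U|jvn].
  split.
  - exact: ultra_weak_limit_proj.
  - exact: nakano_modular_decomposition.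
  - exact: ultra_modular_decomposition.
have H (I : Type) (U : ultrafilter I) : isometric_to_hilbert (weak_kernel E U).
  exact: weak_kernel_hilbert.
split=> //; split=> //; exact: nakano_banach.
Qed.
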